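(* Let $\mathbb{H}=\mathbb{R}$ or $\mathbb{C}$ and let $s>\dim\mathcal{D}$. If $X_s$ is an $N$-point configuration minimizing $$\sum_{i\ne j}\frac{1}{(1-|\langle x_i,x_j\rangle|^2)^{s/2}}$$ over all $\{x_i\}_{i=1}^N\in\mathcal{S}(d,N)$, then $$\xi(X_s)\le 1-\frac{C_2^2}{2}N^{-2/\dim\mathcal{D}},$$ where the constant $C_2>0$ is independent of $N$ and, in the case $\mathbb{H}=\mathbb{R}$ (so that $\dim\mathcal{D}=d-1$), is given by $$C_2=\left(\frac{(d-1)(s-d+1)\,\Gamma\left(\frac{d-1}{2}\right)\Gamma\left(\frac12\right)}{2s\,\Gamma\left(\frac d2\right)}\right)^{\frac{1}{d-1}}\left(\frac{d-1}{s}\right)^{\frac1s}.$$ Consequently, any sequence of such configurations is well-separated as $N\to\infty$.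
   Context: $\mathcal{S}(d,N)$ is the collection of all $N$-point configurations $X=\{x_i\}_{i=1}^N$ (repetitions allowed) of unit vectors in $\mathbb{H}^d$. The summand $1/(1-|\langle x_i,x_j\rangle|^2)^{s/2}$ is $+\infty$ when $|\langle x_i,x_j\rangle|=1$. The coherence of $X$ is $\xi(X)=\max_{i\ne j}|\langle x_i,x_j\rangle|$. $\mathcal{D}=\{xx^*:x\in\mathbb{H}^d,\ \|x\|=1\}$ is the projective space $\mathbb{H}\mathbb{P}^{d-1}$ embedded in the real vector space of $d\times d$ Hermitian matrices over $\mathbb{H}$ with the Frobenius norm; $\dim\mathcal{D}=d-1$ if $\mathbb{H}=\mathbb{R}$ and $\dim\mathcal{D}=2d-2$ if $\mathbb{H}=\mathbb{C}$. A sequence $(X_N)$ of configurations $X_N\in\mathcal{S}(d,N)$ is well-separated if there is a constant $\widetilde C>0$ such that $\xi(X_N)\le 1-\frac{\widetilde C}{2}N^{-2/\dim\mathcal{D}}$ for all $N$. $\Gamma$ is the Gamma function. *)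

(* Defs.v *)
From HB Require Import structures.
From mathcomp Require Import all_boot all_order all_algebra.
From mathcomp Require Import complex.
From mathcomp Require Import all_classical all_reals all_analysis.

Set Implicit Arguments.
Unset Strict Implicit.
Unset Printing Implicit Defensive.

Import Order.TTheory GRing.Theory Num.Theory.
Import numFieldNormedType.Exports.

Local Open Scope classical_set_scope.
Local Open Scope ring_scope.

Inductive scalars := RealScalars | ComplexScalars.

Definition scalarH (R : realType) (H : scalars) : numFieldType :=
  match H with
  | RealScalars => R
  | ComplexScalars => R[i]
  end.

Definition conjH (R : realType) (H : scalars) : scalarH R H -> scalarH R H :=
  match H with
  | RealScalars => fun x => x
  | ComplexScalars => fun x => conjc (x : R[i])
  end.

(* The library norm of R[i] is R[i]-valued (with zero imaginary part); its real
   part gives an R-valued modulus. *)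
Definition absH (R : realType) (H : scalars) : scalarH R H -> R :=
  match H with
  | RealScalars => fun x => `|x|
  | ComplexScalars => fun x => complex.Re `|x|
  end.

Section Configurations.
Variables (R : realType) (H : scalars).
Local Notation K := (scalarH R H).

(* dim D, D being the projective space {x x^* : ||x|| = 1} over the scalars,
   viewed as a real manifold. *)
Definition dimD (d : nat) : nat :=
  match H with
  | RealScalars => (d - 1)%N
  | ComplexScalars => (2 * d - 2)%N
  end.

Definition inner d (x y : 'cV[K]_d) : K :=
  \sum_(k < d) x k 0 * conjH (y k 0).

Definition vnorm d (x : 'cV[K]_d) : R :=
  Num.sqrt (\sum_(k < d) absH (x k 0) ^+ 2).

Definition configuration d N := 'I_N -> 'cV[K]_d.

Definition unit_configs d N : set (configuration d N) :=
  [set X | forall i, vnorm (X i) = 1].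

Definition pair_energy d (s : R) (x y : 'cV[K]_d) : \bar R :=
  if absH (inner x y) == 1 then +oo%E
  else (1 / (1 - absH (inner x y) ^+ 2) `^ (s / 2))%:E.

Definition energy d N (s : R) (X : configuration d N) : \bar R :=
  (\sum_(p : 'I_N * 'I_N | p.1 != p.2) pair_energy s (X p.1) (X p.2))%E.

Definition minimizer d N (s : R) (X : configuration d N) : Prop :=
  unit_configs X /\ forall Y : configuration d N, unit_configs Y ->
    (energy s X <= energy s Y)%E.

(* The terms are nonnegative, so the default value 0 does not affect the
   maximum when N >= 2; for N < 2 there is no pair of distinct indices. *)
Definition coherence d N (X : configuration d N) : R :=
  \big[Num.max/0]_(p : 'I_N * 'I_N | p.1 != p.2) absH (inner (X p.1) (X p.2)).

Definition well_separated d (X : forall N, configuration d N) : Prop :=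
  (forall N, (2 <= N)%N -> unit_configs (X N)) /\
  exists2 C : R, 0 < C &
    forall N, (2 <= N)%N ->
      coherence (X N) <= 1 - C / 2 * N%:R `^ (- (2 / (dimD d)%:R)).

End Configurations.

Definition Gamma (R : realType) (x : R) : R :=
  (\int[lebesgue_measure]_(t in `]0, +oo[) (t `^ (x - 1) * expR (- t)))%R.

Definition C2real (R : realType) (d : nat) (s : R) : R :=
  (((d%:R - 1) * (s - d%:R + 1) * Gamma ((d%:R - 1) / 2) * Gamma (1 / 2))
     / (2 * s * Gamma (d%:R / 2))) `^ (1 / (d%:R - 1))
  * ((d%:R - 1) / s) `^ (1 / s).

(* Main.v *)
Require Import Defs.
From HB Require Import structures.
From mathcomp Require Import all_boot all_order all_algebra.
From mathcomp Require Import complex.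
From mathcomp Require Import all_classical all_reals all_analysis.
From mathcomp Require Import measurable_realfun.
From mathcomp Require Import zify ring lra.

Set Implicit Arguments.
Unset Strict Implicit.
Unset Printing Implicit Defensive.

Import Order.TTheory GRing.Theory Num.Theory.
Import numFieldNormedType.Exports.

Local Open Scope ring_scope.


Section AffineChange.
Local Open Scope classical_set_scope.
Local Open Scope ereal_scope.
Context {R : realType}.
Local Notation mu := (@lebesgue_measure R).
Variables a b : R.

Definition affine (x : R) : measurableTypeR R := (a * x + b)%R.

Lemma measurable_affine : measurable_fun setT affine.
Proof. by apply: measurable_funD => //; exact: mulrl_measurable. Qed.

Definition scaled_affine_image : set (measurableTypeR R) -> \bar R :=
  fun A => `|a|%:E * pushforward mu affine A.

Let image0 : scaled_affine_image set0 = 0.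
Proof. by rewrite /scaled_affine_image /pushforward preimage_set0 measure0 mule0. Qed.

Let image_ge0 A : 0 <= scaled_affine_image A.
Proof. by rewrite /scaled_affine_image /pushforward; apply: mule_ge0; rewrite ?lee_fin. Qed.

Let image_sigma_additive : semi_sigma_additive scaled_affine_image.
Proof.
apply: (@measure_semi_sigma_additive _ _ _ (mscale (NngNum (normr_ge0 a)) (pushforward mu affine))).
exact: measurable_affine.
Qed.

HB.instance Definition _ := isMeasure.Build _ _ _ scaled_affine_image
  image0 image_ge0 image_sigma_additive.

Hypothesis a0 : a != 0%R.

Lemma scaled_affine_imageE A : measurable A -> mu A = scaled_affine_image A.
Proof.
move=> mA.
apply: lebesgue_measure_unique => // _ [[l u]] _ <- /=.
rewrite /scaled_affine_image /pushforward.
have [a_gt0|a_lt0|/eqP] := ltgtP 0%R a; last by rewrite eq_sym (negbTE a0).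
  have -> : affine @^-1` `]l, u] = `]((l - b) / a)%R, ((u - b) / a)%R].
    apply/seteqP; split => x /=; rewrite /affine !in_itv/=;
    by rewrite ltr_pdivrMr// ler_pdivlMr// ltrBlDr lerBrDr (mulrC x).
  rewrite !lebesgue_measure_itv/= !lte_fin ltr_pM2r ?invr_gt0// ltrD2r gtr0_norm//.
  case: ifPn => _; last by rewrite mule0.
  by rewrite -!EFinB -EFinM; congr (_%:E); field; rewrite gt_eqF.
have -> : affine @^-1` `]l, u] = `[((u - b) / a)%R, ((l - b) / a)%R[.
  apply/seteqP; split => x /=; rewrite /affine !in_itv/=;
  by rewrite ltr_ndivlMr// ler_ndivrMr// ltrBlDr lerBrDr (mulrC x) andbC.
rewrite !lebesgue_measure_itv/= !lte_fin ltr_nM2r ?invr_lt0// ltrD2r ltr0_norm//.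
case: ifPn => _; last by rewrite mule0.
by rewrite -!EFinB -EFinM; congr (_%:E); field; rewrite lt_eqF.
Qed.

Lemma ge0_integral_affine (f : R -> \bar R) :
  measurable_fun setT f -> (forall x, 0 <= f x) ->
  \int[mu]_x f x = `|a|%:E * \int[mu]_x f (a * x + b)%R.
Proof.
move=> mf f0.
rewrite (eq_measure_integral scaled_affine_image); last first.
  by move=> A mA _; exact: scaled_affine_imageE.
rewrite (ge0_integral_mscale (pushforward mu affine) measurableT (NngNum (normr_ge0 a)))//=.
  exact: measurable_affine.
by move=> maff; rewrite ge0_integral_pushforward.
Qed.

End AffineChange.

Section Gaussian.
Local Open Scope classical_set_scope.
Local Open Scope ereal_scope.
Context {R : realType}.
Local Notation mu := (@lebesgue_measure R).
Local Notation gauss := (normal_prob (0 : R) 1).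
Local Notation gpdf := (normal_pdf (0 : R) 1).

Lemma ge0_integral_gauss (f : R -> \bar R) :
  measurable_fun setT f -> (forall x, 0 <= f x) ->
  \int[gauss]_x f x = \int[mu]_x (f x * (gpdf x)%:E).
Proof.
move=> mf f0.
have dom : gauss `<< mu by exact: normal_prob_dominates.
rewrite -(Radon_Nikodym_SigmaFinite.change_of_variables dom)//.
have mpdf : measurable_fun setT (fun x => (gpdf x)%:E).
  by apply/measurable_EFinP; exact: measurable_normal_pdf.
have mRN := measurable_int _ (Radon_Nikodym_SigmaFinite.f_integrable dom).
apply: ge0_ae_eq_integral => //.
- exact: emeasurable_funM.
- exact: emeasurable_funM.
- by move=> x _; rewrite mule_ge0// Radon_Nikodym_SigmaFinite.f_ge0.
- by move=> x _; rewrite mule_ge0// lee_fin normal_pdf_ge0.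
apply: ae_eqe_mul2l.
apply: integral_ae_eq => //.
- exact: Radon_Nikodym_SigmaFinite.f_integrable.
- by move=> A _ mA; rewrite -Radon_Nikodym_SigmaFinite.f_integral.
Qed.

(* Tonelli *)
Lemma tonelli d1 d2 (T1 : measurableType d1) (T2 : measurableType d2)
  (m1 : {sigma_finite_measure set T1 -> \bar R})
  (m2 : {sigma_finite_measure set T2 -> \bar R}) (f : T1 -> T2 -> \bar R) :
  measurable_fun setT (fun p : T1 * T2 => f p.1 p.2) ->
  (forall x y, 0 <= f x y) ->
  \int[m1]_x \int[m2]_y f x y = \int[m2]_y \int[m1]_x f x y.
Proof.
move=> mf f0.
exact: (@fubini_tonelli _ _ _ _ _ m1 m2 (fun p => f p.1 p.2) mf (fun p => f0 _ _)).
Qed.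

Lemma tonelli_lebesgue (f : R -> R -> \bar R) :
  measurable_fun setT (fun p : R * R => f p.1 p.2) ->
  (forall x y, 0 <= f x y) ->
  \int[mu]_x \int[mu]_y f x y = \int[mu]_y \int[mu]_x f x y.
Proof. exact: (@tonelli _ _ _ _ mu mu). Qed.

Lemma integral_shear (a : R) (f : R -> R -> \bar R) :
  measurable_fun setT (fun p : R * R => f p.1 p.2) ->
  (forall x y, 0 <= f x y) ->
  \int[mu]_y \int[mu]_x f (x + a * y)%R y = \int[mu]_y \int[mu]_x f x y.
Proof.
move=> mf f0; apply: eq_integral => y _.
rewrite [RHS](ge0_integral_affine (a * y)%R (oner_neq0 _))//.
  by rewrite normr1 mul1e; apply: eq_integral => x _; rewrite mul1r.
exact: (measurable_fun_pair1 (f := fun p : R * R => f p.1 p.2)).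
Qed.

Lemma measurable_linear2 (a b : R) : measurable_fun setT (fun p : R * R => a * p.1 + b * p.2)%R.
Proof.
by apply: measurable_funD; apply: measurable_funM.
Qed.

Lemma integral_rotation (c s : R) (f : R -> R -> \bar R) :
  (0 <= c)%R -> (c ^+ 2 + s ^+ 2 = 1)%R ->
  measurable_fun setT (fun p : R * R => f p.1 p.2) ->
  (forall x y, 0 <= f x y) ->
  \int[mu]_y \int[mu]_x f (c * x + s * y)%R (- s * x + c * y)%R =
  \int[mu]_y \int[mu]_x f x y.
Proof.
move=> c0 cs1 mf f0.
have c1 : (1 + c != 0)%R by rewrite gt_eqF// ltr_wpDr.
pose a := (s / (1 + c))%R.
have mlin (p q r t : R) : measurable_fun setT (fun z : R * R => f (p * z.1 + q * z.2) (r * z.1 + t * z.2))%R.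
  exact: (measurableT_comp mf (measurable_fun_pair (measurable_linear2 p q) (measurable_linear2 r t))).
have E1 : (1 - a * s = c)%R.
  have : (s ^+ 2 = (1 - c) * (1 + c))%R by rewrite -subr_sqr expr1n -cs1 addrAC subrr add0r.
  by move=> s2; rewrite /a mulrAC -expr2 s2 mulfK//; ring.
pose f1 := fun x y : R => f (x + a * y)%R y.
pose f2 := fun x y : R => f1 x (y - s * x)%R.
have mf1 : measurable_fun setT (fun p : R * R => f1 p.1 p.2).
  have := mlin 1%R a 0%R 1%R; apply: eq_measurable_fun => p _.
  by rewrite /f1 !mul1r mul0r add0r.
have mf2 : measurable_fun setT (fun p : R * R => f2 p.1 p.2).
  have := mlin (1 - a * s)%R a (- s)%R 1%R; apply: eq_measurable_fun => p _.
  rewrite /f2 /f1 /=; congr (f _ _); ring.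
transitivity (\int[mu]_y \int[mu]_x f2 (x + a * y)%R y).
  apply: eq_integral => y _; apply: eq_integral => x _; rewrite /f2 /f1.
  congr (f _ _).
    have -> : (x + a * y + a * (y - s * (x + a * y)) = (1 - a * s) * x + a * (1 + (1 - a * s)) * y)%R by ring.
    by rewrite E1; congr (_ + _ * _)%R; rewrite /a divfK.
  have -> : (y - s * (x + a * y) = - s * x + (1 - a * s) * y)%R by ring.
  by rewrite E1.
apply: etrans; first exact: (integral_shear a mf2 (fun x y => f0 _ _)).
have mf2s : measurable_fun setT (fun p : R * R => (fun x y => f2 y x) p.1 p.2).
  exact: (measurableT_comp mf2 (@measurable_swap _ _ R R)).
apply: etrans; first exact: (tonelli_lebesgue mf2s (fun x y => f0 _ _)).
transitivity (\int[mu]_x \int[mu]_y f1 x y); last first.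
  apply: etrans; first exact: (tonelli_lebesgue mf1 (fun x y => f0 _ _)).
  exact: (integral_shear a mf f0).
apply: eq_integral => x _.
rewrite [RHS](ge0_integral_affine (- (s * x))%R (oner_neq0 _))//.
  by rewrite normr1 mul1e; apply: eq_integral => y _; rewrite mul1r.
exact: (measurable_fun_pair2 (f := fun p : R * R => f1 p.1 p.2)).
by move=> y; exact: f0.
Qed.

Lemma gauss_iterated (f : R -> R -> \bar R) :
  measurable_fun setT (fun p : R * R => f p.1 p.2) ->
  (forall x y, 0 <= f x y) ->
  \int[gauss]_y \int[gauss]_x f x y =
  \int[mu]_y \int[mu]_x (f x y * (gpdf x * gpdf y)%:E).
Proof.
move=> mf f0.
have mfs : measurable_fun setT (fun p : R * R => f p.2 p.1).
  exact: (measurableT_comp mf (@measurable_swap _ _ R R)).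
rewrite ge0_integral_gauss; first last.
- by move=> y; apply: integral_ge0 => x _.
- apply: (@measurable_fun_fubini_tonelli_F _ _ _ _ R gauss (fun p : R * R => f p.2 p.1)) => //.
apply: eq_integral => y _.
have mfy : measurable_fun setT (f ^~ y).
  exact: (measurable_fun_pair1 (f := fun p : R * R => f p.1 p.2)).
have mpdf : measurable_fun setT (fun x => (gpdf x)%:E).
  by apply/measurable_EFinP; exact: measurable_normal_pdf.
rewrite ge0_integral_gauss// -ge0_integralZr//; last 3 first.
- exact: emeasurable_funM.
- by move=> x _; rewrite mule_ge0// lee_fin normal_pdf_ge0.
- by rewrite lee_fin normal_pdf_ge0.
by apply: eq_integral => x _; rewrite EFinM muleA.
Qed.

Lemma gauss_rotation (al be : R) (G : R -> R -> \bar R) :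
  (0 <= al)%R ->
  measurable_fun setT (fun p : R * R => G p.1 p.2) ->
  (forall x y, 0 <= G x y) ->
  \int[gauss]_z \int[gauss]_w G (al * w + be * z)%R (w ^+ 2 + z ^+ 2)%R =
  \int[gauss]_z \int[gauss]_w
     G (Num.sqrt (al ^+ 2 + be ^+ 2) * w)%R (w ^+ 2 + z ^+ 2)%R.
Proof.
move=> al0 mG G0.
set rho := Num.sqrt _.
have mG2 (p q : R) : measurable_fun setT
    (fun z : R * R => G (p * z.1 + q * z.2) (z.1 ^+ 2 + z.2 ^+ 2))%R.
  apply: (measurableT_comp mG (measurable_fun_pair (measurable_linear2 p q) _)).
  by apply: measurable_funD; apply: measurable_funX.
have [rho0|rho0] := eqVneq rho 0%R.
  have : (al ^+ 2 + be ^+ 2 == 0)%R.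
    by rewrite eq_le addr_ge0 ?sqr_ge0// andbT -sqrtr_eq0 -/rho rho0.
  rewrite paddr_eq0 ?sqr_ge0// !expf_eq0 => /andP[/eqP -> /eqP ->].
  apply: eq_integral => z _; apply: eq_integral => w _.
  by rewrite rho0 !mul0r addr0.
have rho2 : (rho ^+ 2 = al ^+ 2 + be ^+ 2)%R by rewrite sqr_sqrtr// addr_ge0 ?sqr_ge0.
pose F := fun x y : R => G (rho * x)%R (x ^+ 2 + y ^+ 2)%R * (gpdf x * gpdf y)%:E.
have mF : measurable_fun setT (fun p : R * R => F p.1 p.2).
  apply: emeasurable_funM.
    by have := mG2 rho 0%R; apply: eq_measurable_fun => p _; rewrite mul0r addr0.
  apply/measurable_EFinP; apply: measurable_funM;
  by apply: measurableT_comp => //; exact: measurable_normal_pdf.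
have F0 x y : 0 <= F x y by rewrite mule_ge0// lee_fin mulr_ge0// normal_pdf_ge0.
transitivity (\int[mu]_y \int[mu]_x F ((al / rho) * x + (be / rho) * y)%R
                                    (- (be / rho) * x + (al / rho) * y)%R).
  apply: etrans; first exact: (gauss_iterated (mG2 al be) (fun _ _ => G0 _ _)).
  apply: eq_integral => y _; apply: eq_integral => x _.
  have cs1 : ((al / rho) ^+ 2 + (be / rho) ^+ 2 = 1)%R.
    by rewrite !expr_div_n -mulrDl -rho2 divff// sqrf_eq0.
  rewrite /F; congr (G _ _ * _%:E).
  - by field.
  - transitivity (((al / rho) ^+ 2 + (be / rho) ^+ 2) * (x ^+ 2 + y ^+ 2))%R; last by ring.
    by rewrite cs1 mul1r.
  rewrite !normal_pdfE ?oner_neq0// /normal_fun mulrACA -expRD.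
  rewrite [RHS]mulrACA -expRD; congr (_ * expR _)%R.
  rewrite !subr0 -!mulrDl -!opprD; congr (- _ / _)%R.
  transitivity (((al / rho) ^+ 2 + (be / rho) ^+ 2) * (x ^+ 2 + y ^+ 2))%R; last by ring.
  by rewrite cs1 mul1r.
apply: etrans.
  apply: (integral_rotation _ _ mF F0); first by rewrite divr_ge0// sqrtr_ge0.
  by rewrite !expr_div_n -mulrDl -rho2 divff// sqrf_eq0.
apply/esym; apply: etrans; last by [].
apply: (gauss_iterated (f := fun x y => G (rho * x)%R (x ^+ 2 + y ^+ 2)%R)) => //.
by have := mG2 rho 0%R; apply: eq_measurable_fun => p _; rewrite mul0r addr0.
Qed.

End Gaussian.

Section SquaredNorm.
Local Open Scope classical_set_scope.
Local Open Scope ereal_scope.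
Context {R : realType}.
Local Notation mu := (@lebesgue_measure R).
Local Notation gauss := (normal_prob (0 : R) 1).
Local Notation gpdf := (normal_pdf (0 : R) 1).

Lemma exists_le_mean d (T : measurableType d) (P : probability T R) (f : T -> \bar R) :
  measurable_fun setT f -> (forall x, 0 <= f x) ->
  exists x, f x <= \int[P]_x f x.
Proof.
move=> mf f0; apply: contrapT => /forallNP H.
have {}H x : \int[P]_x f x < f x by rewrite ltNge; exact/negP/H.
have c0 : 0 <= \int[P]_x f x by apply: integral_ge0.
have [x _] : (setT : set T) !=set0.
  apply/set0P/eqP => T0; have := probability_setT P; rewrite T0 measure0 => /eqP.
  by rewrite eq_sym onee_eq0.
have cfin : \int[P]_x f x \is a fin_num.
  by rewrite ge0_fin_numE//; apply: lt_le_trans (H x) _; rewrite leey.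
have [c cE] : exists c, \int[P]_x f x = c%:E by exists (fine (\int[P]_x f x)); rewrite fineK.
have cE' := cE; rewrite cE {cfin x} in H c0.
have mfc : measurable_fun setT (fun x => f x - c%:E) by apply: emeasurable_funB.
have fc0 y : 0 <= f y - c%:E by rewrite sube_ge0// ltW.
have sumE : \int[P]_x f x = \int[P]_x (c%:E + (f x - c%:E)).
  by apply: eq_integral => y _; rewrite addeC subeK.
move: cE'; rewrite sumE ge0_integralD//.
rewrite integral_cst// [X in _ * X](probability_setT P) mule1.
have J0 : 0 <= \int[P]_x (f x - c%:E) by apply: integral_ge0.
move=> cJ; have {}J0 : \int[P]_x (f x - c%:E) = 0.
  case: (\int[P]_x (f x - c%:E)) J0 cJ => //= r _ [] /eqP.
  by rewrite -subr_eq0 addrAC subrr add0r => /eqP ->.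
have : \int[P]_x `|f x - c%:E| = 0.
  by rewrite -[RHS]J0; apply: eq_integral => y _; rewrite gee0_abs.
move/(ae_eq_integral_abs _ measurableT mfc) => [N [mN N0 subN]].
have NT : N = setT.
  apply/seteqP; split => // y _; apply: subN => /= /(_ I) fc.
  by have := H y; rewrite -sube_gt0 fc ltxx.
by have := probability_setT P; rewrite -NT N0 => /esym/eqP; rewrite onee_eq0.
Qed.


Definition sqr_add (p : measurableTypeR R * measurableTypeR R) : measurableTypeR R :=
  (p.1 ^+ 2 + p.2)%R.

Lemma measurable_sqr_add : measurable_fun setT sqr_add.
Proof. by apply: measurable_funD => //; apply: measurable_funX. Qed.

HB.instance Definition _ := isMeasurableFun.Build _ _ _ _ _ measurable_sqr_add.

Fixpoint chi2 (k : nat) : probability (measurableTypeR R) R :=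
  if k is k'.+1 then distribution (gauss \x chi2 k') sqr_add
  else \d_(0%R : measurableTypeR R).

Lemma chi2S k (f : R -> \bar R) :
  measurable_fun setT f -> (forall x, 0 <= f x) ->
  \int[chi2 k.+1]_w f w = \int[chi2 k]_w \int[gauss]_z f (z ^+ 2 + w)%R.
Proof.
move=> mf f0 /=.
rewrite ge0_integral_distribution//.
have mfs : measurable_fun setT (fun p : measurableTypeR R * measurableTypeR R => f (sqr_add p)).
  by apply: measurableT_comp.
by rewrite (fubini_tonelli2 (m1 := gauss) (m2 := chi2 k) (fun p => f (sqr_add p)) mfs (fun p => f0 _)).
Qed.

Lemma measurable_integral_param d1 d2 (T1 : measurableType d1) (T2 : measurableType d2)
  (m : {sigma_finite_measure set T2 -> \bar R}) (f : T1 -> T2 -> \bar R) :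
  measurable_fun setT (fun p : T1 * T2 => f p.1 p.2) ->
  (forall x y, 0 <= f x y) ->
  measurable_fun setT (fun x => \int[m]_y f x y).
Proof.
move=> mf f0.
exact: (@measurable_fun_fubini_tonelli_F _ _ _ _ _ m (fun p => f p.1 p.2) mf (fun p => f0 _ _)).
Qed.

Lemma gauss_sym (f : R -> \bar R) :
  measurable_fun setT f -> (forall x, 0 <= f x) ->
  \int[gauss]_z f (- z)%R = \int[gauss]_z f z.
Proof.
move=> mf f0.
have mpdf : measurable_fun setT (fun x => (gpdf x)%:E).
  by apply/measurable_EFinP; exact: measurable_normal_pdf.
rewrite !ge0_integral_gauss//; last exact: measurableT_comp.
rewrite [RHS](ge0_integral_affine 0%R (ltr0_neq0 (@ltrN10 R) : (-1 != 0 :> R)%R)); first last.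
- by move=> x; rewrite mule_ge0// lee_fin normal_pdf_ge0.
- exact: emeasurable_funM.
rewrite normrN1 mul1e; apply: eq_integral => x _.
rewrite mulN1r addr0; congr (_ * _%:E).
by rewrite !normal_pdfE ?oner_neq0// /normal_fun !subr0 sqrrN.
Qed.


Definition dot (d : nat) (x y : nat -> R) : R := \sum_(k < d) x k * y k.
Definition sqn (d : nat) (x : nat -> R) : R := \sum_(k < d) x k ^+ 2.

Lemma sqn_ge0 d x : (0 <= sqn d x)%R.
Proof. by apply: sumr_ge0 => k _; exact: sqr_ge0. Qed.

Definition scons d (x : nat -> R) (z : R) : nat -> R := fun k => if k == d then z else x k.

Lemma dot_scons d x z y : (dot d.+1 (scons d x z) y = dot d x y + z * y d)%R.
Proof.
rewrite /dot big_ord_recr /= /scons eqxx; congr (_ + _)%R.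
by apply: eq_bigr => k _; rewrite ltn_eqF.
Qed.

Lemma sqn_scons d x z : (sqn d.+1 (scons d x z) = sqn d x + z ^+ 2)%R.
Proof.
rewrite /sqn big_ord_recr /= /scons eqxx; congr (_ + _)%R.
by apply: eq_bigr => k _; rewrite ltn_eqF.
Qed.

Lemma sqnS d x : (sqn d.+1 x = sqn d x + x d ^+ 2)%R.
Proof. by rewrite /sqn big_ord_recr. Qed.

(* mean of g(<x,y>,|x|^2) for a Gaussian vector x in dimension d+1 *)
Definition mean (d : nat) (g : R -> R -> \bar R) (a : R) : \bar R :=
  \int[chi2 d]_w \int[gauss]_z g (a * z)%R (z ^+ 2 + w)%R.

Lemma meanS d (g : R -> R -> \bar R) (a b : R) :
  measurable_fun setT (fun p : R * R => g p.1 p.2) ->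
  (forall x y, 0 <= g x y) -> (0 <= a)%R ->
  \int[gauss]_z mean d (fun u v => g (u + z * b) (v + z ^+ 2))%R a =
  mean d.+1 g (Num.sqrt (a ^+ 2 + b ^+ 2)).
Proof.
move=> mg g0 a0.
have mG : measurable_fun setT (fun q : ((R * R) * R) =>
   g (a * q.2 + q.1.1 * b) ((q.2 ^+ 2 + q.1.2) + q.1.1 ^+ 2))%R.
  apply: (measurableT_comp mg (measurable_fun_pair _ _)).
  + by apply: measurable_funD; apply: measurable_funM => //; apply: measurableT_comp.
  + apply: measurable_funD; first apply: measurable_funD.
    * by apply: measurable_funX.
    * by apply: measurableT_comp.
    * by apply: measurable_funX; apply: measurableT_comp.
rewrite /mean (tonelli gauss (chi2 d)
  (f := fun z w => \int[gauss]_x g (a * x + z * b)%R (x ^+ 2 + w + z ^+ 2)%R)); first last.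
- by move=> z w; apply: integral_ge0.
- exact: (measurable_integral_param (T1 := (R * R)%type) gauss mG (fun _ _ => g0 _ _)).
set r := Num.sqrt _.
have mr : measurable_fun setT (fun q : (R * R) => g (r * q.2) (q.2 ^+ 2 + q.1))%R.
  apply: (measurableT_comp mg (measurable_fun_pair _ _)).
    by apply: measurable_funM.
  by apply: measurable_funD => //; apply: measurable_funX.
rewrite chi2S; first last.
- by move=> w; apply: integral_ge0.
- exact: (measurable_integral_param (T1 := R) gauss mr (fun _ _ => g0 _ _)).
apply: eq_integral => w _.
have mGw : measurable_fun setT (fun p : R * R => g p.1 (p.2 + w)%R).
  apply: (measurableT_comp mg (measurable_fun_pair _ _)) => //.
  by apply: measurable_funD.
transitivity (\int[gauss]_z \int[gauss]_x g (a * x + b * z)%R (x ^+ 2 + z ^+ 2 + w)%R).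
  apply: eq_integral => z _; apply: eq_integral => x _.
  by rewrite (mulrC z) addrAC.
apply: etrans; first exact: (gauss_rotation (G := fun u v => g u (v + w)%R) b a0 mGw (fun _ _ => g0 _ _)).
by apply: eq_integral => z _; apply: eq_integral => x _; rewrite addrA.
Qed.

Lemma measurable_sqr : measurable_fun [set: R] (fun z : R => z ^+ 2)%R.
Proof. exact: exprn_measurable. Qed.

Lemma mean0 (g : R -> R -> \bar R) (a : R) :
  measurable_fun setT (fun p : R * R => g p.1 p.2) ->
  (forall x y, 0 <= g x y) ->
  mean 0 g `|a|%R = \int[gauss]_z g (a * z)%R (z ^+ 2)%R.
Proof.
move=> mg g0.
have mr r : measurable_fun setT (fun q : (R * R) => g (r * q.2) (q.2 ^+ 2 + q.1))%R.
  apply: (measurableT_comp mg (measurable_fun_pair _ _)).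
    by apply: measurable_funM.
  by apply: measurable_funD => //; apply: measurable_funX.
rewrite /mean /= integral_dirac//; last first.
  exact: (measurable_integral_param (T1 := R) gauss (mr _) (fun _ _ => g0 _ _)).
rewrite diracT mul1e.
have mr1 r : measurable_fun setT (fun z : R => g (r * z)%R (z ^+ 2)%R).
  exact: (measurableT_comp mg (measurable_fun_pair (mulrl_measurable _) measurable_sqr)).
under eq_integral do rewrite addr0.
have [a0|a0] := leP 0%R a; first by rewrite ger0_norm.
rewrite ltr0_norm// -[RHS]gauss_sym//.
by apply: eq_integral => z _; rewrite sqrrN mulrN mulNr.
Qed.

Lemma measurable_mean d (g : R -> R -> \bar R) (a b : R) :
  measurable_fun setT (fun p : R * R => g p.1 p.2) ->
  (forall x y, 0 <= g x y) ->
  measurable_fun setT (fun z : R => mean d (fun u v => g (u + z * b) (v + z ^+ 2))%R a).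
Proof.
move=> mg g0.
have mG : measurable_fun setT (fun q : ((R * R) * R) =>
   g (a * q.2 + q.1.1 * b) ((q.2 ^+ 2 + q.1.2) + q.1.1 ^+ 2))%R.
  apply: (measurableT_comp mg (measurable_fun_pair _ _)).
  + by apply: measurable_funD; apply: measurable_funM => //; apply: measurableT_comp.
  + apply: measurable_funD; first apply: measurable_funD.
    * by apply: measurable_funX.
    * by apply: measurableT_comp.
    * by apply: measurable_funX; apply: measurableT_comp.
apply: (measurable_integral_param (T1 := R) (chi2 d)
  (f := fun z w => \int[gauss]_x g (a * x + z * b)%R (x ^+ 2 + w + z ^+ 2)%R)).
  exact: (measurable_integral_param (T1 := (R * R)%type) gauss mG (fun _ _ => g0 _ _)).
by move=> z w; apply: integral_ge0.
Qed.

Lemma mean_ge0 d (g : R -> R -> \bar R) a : (forall x y, 0 <= g x y) -> 0 <= mean d g a.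
Proof. by move=> g0; apply: integral_ge0 => w _; apply: integral_ge0. Qed.

Lemma exists_le_sum_mean (I : Type) (s : seq I) d (g : I -> R -> R -> \bar R)
    (y : I -> nat -> R) :
  (forall i, measurable_fun setT (fun p : R * R => g i p.1 p.2)) ->
  (forall i u v, 0 <= g i u v) ->
  exists x : nat -> R,
    \sum_(i <- s) g i (dot d.+1 x (y i)) (sqn d.+1 x) <=
    \sum_(i <- s) mean d (g i) (Num.sqrt (sqn d.+1 (y i))).
Proof.
elim: d g => [|d IH] g mg g0.
  have mf i : measurable_fun setT (fun z : R => g i (y i 0%N * z)%R (z ^+ 2)%R).
    exact: (measurableT_comp (mg i) (measurable_fun_pair (mulrl_measurable _) measurable_sqr)).
  have [||z zP] := @exists_le_mean _ _ gauss
    (fun z => \sum_(i <- s) g i (y i 0%N * z)%R (z ^+ 2)%R).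
  - exact: emeasurable_sum.
  - by move=> z; apply: sume_ge0.
  exists (fun=> z); rewrite (le_trans _ (le_trans zP _))//.
    by apply: lee_sum => i _; rewrite /dot /sqn !big_ord1 mulrC.
  rewrite ge0_integral_sum//; apply: lee_sum => i _.
  by rewrite /sqn big_ord1 sqrtr_sqr mean0.
pose g' z i := fun u v => g i (u + z * y i d.+1)%R (v + z ^+ 2)%R.
have mg' z i : measurable_fun setT (fun p : R * R => g' z i p.1 p.2).
  apply: (measurableT_comp (mg i) (measurable_fun_pair _ _));
  by apply: measurable_funD.
have IHz z := IH (g' z) (mg' z) (fun _ _ _ => g0 _ _ _).
have mm i := measurable_mean d (Num.sqrt (sqn d.+1 (y i))) (y i d.+1) (mg i) (g0 i).
have [||z zP] := @exists_le_mean _ _ gauss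
    (fun z => \sum_(i <- s) mean d (g' z i) (Num.sqrt (sqn d.+1 (y i)))).
- exact: emeasurable_sum.
- by move=> z; apply: sume_ge0 => i _; apply: mean_ge0 => u v; exact: g0.
have [x xP] := IHz z.
exists (scons d.+1 x z).
apply: (@le_trans _ _ (\sum_(i <- s) g' z i (dot d.+1 x (y i)) (sqn d.+1 x))).
  by apply: lee_sum => i _; rewrite dot_scons sqn_scons.
apply: le_trans xP _; apply: le_trans zP _.
rewrite ge0_integral_sum//; last first.
  by move=> i z' _; apply: mean_ge0 => u v; exact: g0.
apply: lee_sum => i _.
have E := meanS d (y i d.+1) (mg i) (g0 i) (sqrtr_ge0 (sqn d.+1 (y i))).
rewrite sqr_sqrtr ?sqn_ge0// -sqnS in E.
by rewrite le_eqVlt; apply/orP; left; apply/eqP; exact: E.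
Qed.

End SquaredNorm.

Section CotangentLaw.
Local Open Scope classical_set_scope.
Local Open Scope ereal_scope.
Context {R : realType}.
Local Notation mu := (@lebesgue_measure R).
Local Notation gauss := (normal_prob (0 : R) 1).
Local Notation gpdf := (normal_pdf (0 : R) 1).
Local Notation peak := (normal_peak (1 : R)).

Definition sine (t : R) : R := (Num.sqrt (1 + t ^+ 2))^-1.

Lemma one_sqr_gt0 (t : R) : (0 < 1 + t ^+ 2)%R.
Proof. by rewrite ltr_pwDl// sqr_ge0. Qed.

Lemma sine_gt0 t : (0 < sine t)%R.
Proof. by rewrite invr_gt0 sqrtr_gt0 one_sqr_gt0. Qed.

Lemma sqr_sine t : (sine t ^+ 2 = (1 + t ^+ 2)^-1)%R.
Proof. by rewrite exprVn sqr_sqrtr// ltW// one_sqr_gt0. Qed.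

Lemma gpdfE (x : R) : gpdf x = (peak * expR (- x ^+ 2 / 2))%R.
Proof. by rewrite normal_pdfE ?oner_neq0// /normal_fun subr0 expr1n. Qed.

Lemma chi2_lt0 k : chi2 k [set w : R | (w < 0)%R] = 0.
Proof.
have mneg : measurable [set w : R | (w < 0)%R].
  by rewrite -set_itvNyo; exact: measurable_itv.
elim: k => [|k IH]; first by rewrite /= diracE memNset//= ltxx.
apply/eqP; rewrite -measure_le0.
apply: (@le_trans _ _ ((gauss \x chi2 k) (setT `*` [set w : R | (w < 0)%R]))).
  rewrite /= /distribution /pushforward; apply: le_measure; rewrite ?inE.
  - by rewrite -[X in measurable X]setTI; exact: measurable_sqr_add.
  - exact: measurableX.
  - move=> [z w]; rewrite /= /sqr_add/= => zw; split => //.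
    by apply: le_lt_trans zw; rewrite lerDr sqr_ge0.
by rewrite product_measure1E//= IH mule0.
Qed.

Lemma chi2_le0 k : chi2 k.+1 [set w : R | (w <= 0)%R] = 0.
Proof.
have mneg : measurable [set w : R | (w < 0)%R].
  by rewrite -set_itvNyo; exact: measurable_itv.
have mnpos : measurable [set w : R | (w <= 0)%R].
  by rewrite -set_itvNyc; exact: measurable_itv.
apply/eqP; rewrite -measure_le0.
apply: (@le_trans _ _ ((gauss \x chi2 k)
    ((setT `*` [set w : R | (w < 0)%R]) `|` ([set 0%R] `*` setT)))).
  rewrite /= /distribution /pushforward; apply: le_measure; rewrite ?inE.
  - by rewrite -[X in measurable X]setTI; exact: measurable_sqr_add.
  - by apply: measurableU; apply: measurableX.
  - move=> [z w]; rewrite /= /sqr_add/= => zw.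
    have [w0|w0] := ltP w 0%R; [by left|right; split => //].
    apply/eqP; rewrite -sqrf_eq0 eq_le sqr_ge0 andbT.
    by apply: le_trans zw; rewrite lerDl.
apply: le_trans (measureU2 _ _ _) _; [exact: measurableX..|].
rewrite /= !product_measure1E//= chi2_lt0 mule0 add0e.
have -> : gauss [set 0%R] = 0.
  apply: (proj1 (null_content_dominatesP _ _) (normal_prob_dominates 0%R 1%R)) => //.
  exact: lebesgue_measure_set1.
by rewrite mul0e.
Qed.

Lemma chi2_scaling k (t : R) (f : R -> \bar R) :
  measurable_fun setT f -> (forall x, 0 <= f x) ->
  \int[chi2 k]_w (f w * (expR (- w * t ^+ 2 / 2))%:E) =
  (sine t ^+ k)%:E * \int[chi2 k]_w f (sine t ^+ 2 * w)%R.
Proof.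
have mexp : measurable_fun setT (fun w : R => (expR (- w * t ^+ 2 / 2))%:E).
  apply/measurable_EFinP; apply: measurableT_comp => //.
  by apply: measurable_funM => //; apply: measurable_funM.
have b0 := sine_gt0 t; have b2 := sqr_sine t.
have mscale (g : R -> \bar R) : measurable_fun setT g ->
    measurable_fun setT (fun w : R => g (sine t ^+ 2 * w)%R).
  by move=> mg; exact: (measurableT_comp mg (mulrl_measurable _)).
elim: k f => [|k IH] f mf f0.
  rewrite /= !integral_dirac//.
  - by rewrite !diracT !mul1e mulr0 oppr0 !mul0r expR0 mule1.
  - exact: mscale.
  - exact: emeasurable_funM.
have mfE : measurable_fun setT (fun w => f w * (expR (- w * t ^+ 2 / 2))%:E).
  exact: emeasurable_funM.
rewrite chi2S//; last by move=> w; rewrite mule_ge0// lee_fin expR_ge0.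
pose Phi w := \int[gauss]_z (f (z ^+ 2 + w)%R * (expR (- z ^+ 2 * t ^+ 2 / 2))%:E).
have mPhi0 : measurable_fun setT (fun p : R * R =>
    f (p.2 ^+ 2 + p.1)%R * (expR (- p.2 ^+ 2 * t ^+ 2 / 2))%:E).
  apply: emeasurable_funM.
    by apply: (measurableT_comp mf); apply: measurable_funD => //; apply: measurable_funX.
  have m2 : measurable_fun setT (fun p : R * R => p.2 ^+ 2)%R by apply: measurable_funX.
  exact: (measurableT_comp mexp m2).
have P0 (w z : R) : 0 <= f (z ^+ 2 + w)%R * (expR (- z ^+ 2 * t ^+ 2 / 2))%:E.
  by rewrite mule_ge0// lee_fin expR_ge0.
have mPhi : measurable_fun setT Phi.
  exact: (measurable_integral_param (T1 := R) gauss mPhi0 P0).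
have Phi0 w : 0 <= Phi w.
  by apply: integral_ge0 => z _; rewrite mule_ge0// lee_fin expR_ge0.
transitivity (\int[chi2 k]_w (Phi w * (expR (- w * t ^+ 2 / 2))%:E)).
  apply: eq_integral => w _.
  rewrite /Phi -ge0_integralZr//; last first.
    exact: (measurable_fun_pair2 (f := fun p : R * R =>
      f (p.2 ^+ 2 + p.1)%R * (expR (- p.2 ^+ 2 * t ^+ 2 / 2))%:E)).
  apply: eq_integral => z _; rewrite -muleA -EFinM -expRD; congr (_ * (expR _)%:E).
  by rewrite opprD !mulrDl.
rewrite IH// [X in X%:E * \int[chi2 k.+1]_w _]exprSr EFinM -muleA; congr (_ * _).
have mfb : measurable_fun setT (fun w : R => f (sine t ^+ 2 * w)%R).
  exact: mscale.
rewrite chi2S//.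
have mfb2 : measurable_fun setT (fun p : R * R => f (sine t ^+ 2 * (p.2 ^+ 2 + p.1))%R).
  by apply: (measurableT_comp mfb); apply: measurable_funD => //; apply: measurable_funX.
rewrite -ge0_integralZl//; first last.
- by rewrite lee_fin ltW.
- by move=> w _; apply: integral_ge0.
- exact: (measurable_integral_param (T1 := R) gauss mfb2 (fun _ _ => f0 _)).
apply: eq_integral => w _; rewrite /Phi.
have mP : measurable_fun setT (fun z : R =>
    f (z ^+ 2 + sine t ^+ 2 * w)%R * (expR (- z ^+ 2 * t ^+ 2 / 2))%:E).
  exact: (measurable_fun_pair2 (f := fun p : R * R =>
      f (p.2 ^+ 2 + p.1)%R * (expR (- p.2 ^+ 2 * t ^+ 2 / 2))%:E)).
have mpdf : measurable_fun setT (fun x => (gpdf x)%:E).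
  by apply/measurable_EFinP; exact: measurable_normal_pdf.
rewrite ge0_integral_gauss//.
rewrite (ge0_integral_affine 0%R (lt0r_neq0 b0)); first last.
- by move=> z; rewrite !mule_ge0// lee_fin ?expR_ge0// normal_pdf_ge0.
- exact: emeasurable_funM.
rewrite (ger0_norm (ltW b0)); congr (_ * _).
rewrite ge0_integral_gauss//; last first.
  exact: (measurable_fun_pair2 (f := fun p : R * R => f (sine t ^+ 2 * (p.2 ^+ 2 + p.1))%R)).
apply: eq_integral => z _.
rewrite addr0 exprMn -mulrDr -muleA -EFinM; congr (_ * _%:E).
rewrite !gpdfE mulrCA -expRD; congr (_ * expR _)%R.
rewrite exprMn b2; field; rewrite lt0r_neq0// one_sqr_gt0//.
Qed.

End CotangentLaw.

Section CotangentLaw2.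
Local Open Scope classical_set_scope.
Local Open Scope ereal_scope.
Context {R : realType}.
Local Notation mu := (@lebesgue_measure R).
Local Notation gauss := (normal_prob (0 : R) 1).
Local Notation gpdf := (normal_pdf (0 : R) 1).
Local Notation peak := (normal_peak (1 : R)).

Lemma sine_le1 (t : R) : (sine t <= 1)%R.
Proof.
rewrite /sine invf_le1 ?sqrtr_gt0 ?one_sqr_gt0//.
by rewrite -[leLHS]sqrtr1 ler_wsqrtr// lerDl sqr_ge0.
Qed.

Lemma continuous_sine : continuous (@sine R).
Proof.
move=> t; apply: cvgV => /=; first by rewrite gt_eqF// sqrtr_gt0 one_sqr_gt0.
apply: (@continuous_comp _ _ _ (fun t : R => 1 + t ^+ 2)%R Num.sqrt); last exact: sqrt_continuous.
by apply: cvgD; [exact: cvg_cst|exact: exprn_continuous].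
Qed.

Lemma measurable_sine : measurable_fun setT (@sine R).
Proof. exact: continuous_measurable_fun continuous_sine. Qed.

Lemma mean_homogeneous k (g : R -> R -> \bar R) (h : R -> \bar R) :
  measurable_fun setT (fun p : R * R => g p.1 p.2) ->
  (forall x y, 0 <= g x y) ->
  measurable_fun setT h -> (forall x, 0 <= h x) ->
  (forall z w, (0 < w)%R -> g z (z ^+ 2 + w)%R = h (z / Num.sqrt w)%R) ->
  mean k.+1 g 1 =
  (peak%:E * \int[chi2 k.+1]_w (Num.sqrt w)%:E) * \int[mu]_t (h t * (sine t ^+ k.+2)%:E).
Proof.
move=> mg g0 mh h0 gh.
have msqrt : measurable_fun setT (fun w : R => (Num.sqrt w)%:E).
  apply/measurable_EFinP.
  by apply: continuous_measurable_fun; exact: sqrt_continuous.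
pose G (t w : R) := h t * (Num.sqrt w * gpdf (Num.sqrt w * t))%:E.
have msqrtR : measurable_fun [set: R] (@Num.sqrt R) by apply/measurable_EFinP.
have mpdf : measurable_fun setT (fun x => (gpdf x)%:E).
  by apply/measurable_EFinP; exact: measurable_normal_pdf.
have sqrt2 : measurable_fun setT (fun p : R * R => Num.sqrt p.2) by apply: measurableT_comp.
have mG : measurable_fun setT (fun p : R * R => G p.1 p.2).
  apply: emeasurable_funM; first exact: measurableT_comp.
  apply/measurable_EFinP; apply: measurable_funM => //.
  apply: (measurableT_comp (measurable_normal_pdf 0%R 1%R)).
  exact: measurable_funM.
have G0 t w : 0 <= G t w by rewrite mule_ge0// lee_fin mulr_ge0// ?sqrtr_ge0// normal_pdf_ge0.
have mg1 : measurable_fun setT (fun p : R * R => g (1 * p.2)%R (p.2 ^+ 2 + p.1)%R).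
  apply: (measurableT_comp mg (measurable_fun_pair _ _)).
    by apply: measurable_funM.
  by apply: measurable_funD => //; apply: measurable_funX.
have mGs : measurable_fun setT (fun p : R * R => G p.2 p.1).
  exact: (measurableT_comp mG (@measurable_swap _ _ R R)).
transitivity (\int[chi2 k.+1]_w \int[mu]_t G t w).
  apply: ge0_ae_eq_integral => //.
  - exact: (measurable_integral_param (T1 := R) gauss mg1 (fun _ _ => g0 _ _)).
  - exact: (measurable_integral_param (T1 := R) mu mGs (fun _ _ => G0 _ _)).
  - by move=> w _; apply: integral_ge0.
  - by move=> w _; apply: integral_ge0.
  exists [set w : R | (w <= 0)%R]; split.
  - by rewrite -set_itvNyc; exact: measurable_itv.
  - exact: chi2_le0.
  move=> w /= Hw; rewrite leNgt; apply/negP => w0; apply: Hw => _.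
  have sw0 : (0 < Num.sqrt w)%R by rewrite sqrtr_gt0.
  have mgw : measurable_fun setT (fun z : R => g (1 * z)%R (z ^+ 2 + w)%R).
    exact: (measurable_fun_pair2 (f := fun p : R * R => g (1 * p.2)%R (p.2 ^+ 2 + p.1)%R)).
  rewrite ge0_integral_gauss//.
  rewrite (ge0_integral_affine 0%R (lt0r_neq0 sw0)); first last.
  - by move=> z; rewrite mule_ge0// lee_fin normal_pdf_ge0.
  - exact: emeasurable_funM.
  have mhp : measurable_fun setT (fun t : R => h t * (gpdf (Num.sqrt w * t))%:E).
    apply: emeasurable_funM => //; apply: (measurableT_comp mpdf).
    exact: mulrl_measurable.
  rewrite (ger0_norm (ltW sw0)).
  transitivity ((Num.sqrt w)%:E * \int[mu]_t (h t * (gpdf (Num.sqrt w * t))%:E)).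
    congr (_ * _); apply: eq_integral => t _.
    by rewrite mul1r addr0 gh//; congr (h _ * _); rewrite mulrC mulKf// lt0r_neq0.
  rewrite -ge0_integralZl_EFin ?ltW//; last first.
    by move=> t _; rewrite mule_ge0// lee_fin normal_pdf_ge0.
  by apply: eq_integral => t _; rewrite /G EFinM muleCA.
rewrite -(tonelli mu (chi2 k.+1) mG G0).
transitivity (\int[mu]_t ((peak%:E * \int[chi2 k.+1]_w (Num.sqrt w)%:E) * (h t * (sine t ^+ k.+2)%:E))).
  apply: eq_integral => t _.
  have mexp : measurable_fun setT (fun w : R => (expR (- w * t ^+ 2 / 2))%:E).
    apply/measurable_EFinP; apply: measurableT_comp => //.
    by apply: measurable_funM => //; apply: measurable_funM.
  set S := \int[chi2 k.+1]_w (Num.sqrt w)%:E.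
  have E : \int[chi2 k.+1]_w ((Num.sqrt w)%:E * (expR (- w * t ^+ 2 / 2))%:E) =
      (sine t ^+ k.+2)%:E * S.
    apply: etrans; first exact: (chi2_scaling k.+1 t msqrt (fun x => sqrtr_ge0 x)).
    rewrite [in RHS]exprSr EFinM -muleA; congr (_ * _).
    rewrite -ge0_integralZl_EFin//; last by rewrite ltW// sine_gt0.
    apply: eq_integral => w _.
    by rewrite sqrtrM ?sqr_ge0// sqrtr_sqr ger0_norm ?ltW ?sine_gt0// EFinM.
  transitivity ((h t * peak%:E) * ((sine t ^+ k.+2)%:E * S)); last first.
    by rewrite muleACA muleC.
  apply: etrans; last exact: (congr1 (fun x => h t * peak%:E * x) E).
  rewrite -ge0_integralZl//; first last.
  - by rewrite mule_ge0// lee_fin normal_peak_ge0.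
  - exact: emeasurable_funM.
  apply: eq_integral => w _; rewrite /G gpdfE -muleA; congr (_ * _).
  rewrite -!EFinM mulrCA; congr (_ * _)%:E.
  have [w0|w0] := leP 0%R w; last by rewrite ler0_sqrtr ?ltW// !mul0r.
  by rewrite exprMn sqr_sqrtr// !mulNr.
have mhs : measurable_fun setT (fun t => h t * (sine t ^+ k.+2)%:E).
  apply: emeasurable_funM => //; apply/measurable_EFinP; apply: measurable_funX.
  exact: measurable_sine.
rewrite ge0_integralZl//.
- by move=> t _; rewrite mule_ge0// lee_fin exprn_ge0// ltW// sine_gt0.
- rewrite mule_ge0// ?lee_fin ?normal_peak_ge0//.
  by apply: integral_ge0 => w _; rewrite lee_fin sqrtr_ge0.
Qed.

End CotangentLaw2.

Section ZonalMean.
Local Open Scope classical_set_scope.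
Local Open Scope ereal_scope.
Context {R : realType}.
Local Notation mu := (@lebesgue_measure R).
Local Notation gauss := (normal_prob (0 : R) 1).

Definition sine_mass (k : nat) : \bar R := \int[mu]_t (sine t ^+ k)%:E.

Local Notation peak := (normal_peak (1 : R)).

Variable K : R -> R.
Hypothesis mK : measurable_fun setT K.
Hypothesis K0 : forall q, (0 <= K q)%R.

Definition kernel (a b : R) : R := if (a ^+ 2 < b)%R then K (1 - a ^+ 2 / b)%R else 1%R.

Lemma kernel_ge0 a b : (0 <= kernel a b)%R.
Proof. by rewrite /kernel; case: ifP. Qed.

Lemma measurable_kernel : measurable_fun setT (fun p : R * R => (kernel p.1 p.2)%:E).
Proof.
have -> : (fun p : R * R => (kernel p.1 p.2)%:E) = (fun p : R * R =>
    (if (p.1 ^+ 2 < p.2)%R then K (1 - p.1 ^+ 2 * p.2 `^ (-1))%R else 1%R)%:E).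
  apply/funext => -[a b]; rewrite /kernel/=; case: ifPn => // ab.
  by rewrite powR_inv1// (le_trans _ (ltW ab))// sqr_ge0.
apply/measurable_EFinP; apply: measurable_fun_ifT => //.
  by apply: measurable_fun_ltr => //; apply: measurable_funX.
apply: (measurableT_comp mK); apply: measurable_funB => //.
apply: measurable_funM; first exact: measurable_funX.
have m2 : measurable_fun setT (fun p : R * R => p.2) by exact: measurable_snd.
exact: (measurableT_comp (measurable_powR (-1)%R) m2).
Qed.

Lemma mean_cst1 k : mean k (fun _ _ => 1%E) (1 : R) = 1.
Proof.
rewrite /mean; under eq_integral do rewrite integral_cst// [X in _ * X]probability_setT mule1.
by rewrite integral_cst// [X in _ * X]probability_setT mule1.
Qed.

Lemma mean_kernel k :
  mean k.+1 (fun a b => (kernel a b)%:E) (1 : R) * sine_mass k.+2 =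
  \int[mu]_t ((K (sine t ^+ 2))%:E * (sine t ^+ k.+2)%:E).
Proof.
have mKs : measurable_fun setT (fun t => (K (sine t ^+ 2))%:E).
  apply/measurable_EFinP; apply: measurableT_comp => //.
  by apply: measurable_funX; exact: measurable_sine.
have gh z w : (0 < w)%R ->
    (kernel z (z ^+ 2 + w)%R)%:E = (K (sine (z / Num.sqrt w)%R ^+ 2))%:E.
  move=> w0; rewrite /kernel ltrDl w0 sqr_sine; congr (K _)%:E.
  rewrite expr_div_n sqr_sqrtr ?(ltW w0)//.
  have zw : (z ^+ 2 + w != 0)%R by rewrite gt_eqF// ltr_wpDl ?sqr_ge0.
  have wz : (w + z ^+ 2 != 0)%R by rewrite addrC.
  by field; rewrite ?zw ?wz ?(gt_eqF w0).
have kg0 a b : 0 <= (kernel a b)%:E by rewrite lee_fin kernel_ge0.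
have hK0 t : 0 <= (K (sine t ^+ 2))%:E by rewrite lee_fin.
rewrite (mean_homogeneous k measurable_kernel kg0 mKs hK0 gh).
set c := peak%:E * _; set J := \int[mu]_t _.
have c1 : c * sine_mass k.+2 = 1.
  rewrite -(mean_cst1 k.+1) (mean_homogeneous k (g := fun _ _ => 1) (h := fun=> 1))//.
  by congr (_ * _); apply: eq_integral => t _; rewrite mul1e.
by rewrite muleAC c1 mul1e.
Qed.

Lemma exists_unit_kernel (I : Type) (s : seq I) k (y : I -> nat -> R) :
  (0 < size s)%N -> (forall i, sqn k.+2 (y i) = 1%R) ->
  sine_mass k.+2 \is a fin_num ->
  (size s)%:R%:E * \int[mu]_t ((K (sine t ^+ 2))%:E * (sine t ^+ k.+2)%:E) < sine_mass k.+2 ->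
  exists2 x : nat -> R, sqn k.+2 x = 1%R &
    (\sum_(i <- s) kernel (dot k.+2 x (y i)) 1 < 1)%R.
Proof.
move=> s0 y1 Ifin small.
have I0 : 0 < sine_mass k.+2.
  apply: le_lt_trans small; rewrite mule_ge0// ?lee_fin//.
  by apply: integral_ge0 => t _; rewrite mule_ge0// lee_fin ?exprn_ge0// ltW// sine_gt0.
have kg0 a b : 0 <= (kernel a b)%:E by rewrite lee_fin kernel_ge0.
have [x xP] := exists_le_sum_mean s k.+1 y (fun=> measurable_kernel) (fun=> kg0).
have {}xP : (\sum_(i <- s) kernel (dot k.+2 x (y i)) (sqn k.+2 x) < 1)%R.
  rewrite -lte_fin -sumEFin; apply: le_lt_trans xP _.
  under eq_bigr do rewrite y1 sqrtr1.
  set M := mean _ _ _.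
  have -> : \sum_(i <- s) M = (size s)%:R%:E * M.
    have M0 : 0 <= M by apply: mean_ge0.
    elim: {small s0} s => [|i s IH]; first by rewrite big_nil mul0e.
    rewrite big_cons IH /= -natr1 EFinD addeC ge0_muleDl ?mul1e ?lee_fin//.
  rewrite ltNge; apply/negP => H; move: small; rewrite ltNge => /negP; apply.
  rewrite -mean_kernel -/M muleA -[leLHS]mul1e.
  by apply: lee_wpmul2r => //; exact: ltW.
set n := sqn k.+2 x in xP.
have n0 : (0 < n)%R.
  rewrite lt_neqAle sqn_ge0 andbT; apply/eqP => n0; move: xP; rewrite -n0.
  under eq_bigr do rewrite /kernel ltNge sqr_ge0/=.
  by rewrite big_const_seq count_predT iter_addr addr0 ltNge ler1n s0.
exists (fun j => x j / Num.sqrt n)%R.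
  rewrite /sqn; under eq_bigr do rewrite expr_div_n.
  by rewrite -mulr_suml -/(sqn _ _) -/n sqr_sqrtr ?ltW// divff ?gt_eqF.
rewrite (le_lt_trans _ xP)//; apply: ler_sum => i _.
have -> : dot k.+2 (fun j => x j / Num.sqrt n)%R (y i) = (dot k.+2 x (y i) / Num.sqrt n)%R.
  by rewrite /dot mulr_suml; apply: eq_bigr => j _; rewrite mulrAC.
rewrite /kernel expr_div_n sqr_sqrtr ?(ltW n0)// ltr_pdivrMr// mul1r.
by case: ifPn => //; rewrite divr1.
Qed.

End ZonalMean.

Section GammaBeta.
Local Open Scope classical_set_scope.
Local Open Scope ereal_scope.
Context {R : realType}.
Local Notation mu := (@lebesgue_measure R).

Definition gamma_fun (x t : R) : R := if (0 < t)%R then (t `^ (x - 1) * expR (- t))%R else 0%R.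
Definition eGamma (x : R) : \bar R := \int[mu]_t (gamma_fun x t)%:E.

Lemma gamma_fun_ge0 x t : (0 <= gamma_fun x t)%R.
Proof. by rewrite /gamma_fun; case: ifP => // _; rewrite mulr_ge0 ?powR_ge0 ?expR_ge0. Qed.

Lemma measurable_gamma_fun x : measurable_fun setT (gamma_fun x).
Proof.
apply: measurable_fun_ifT => //; first exact: measurable_fun_ltr.
apply: measurable_funM; first exact: measurable_powR.
by apply: measurableT_comp.
Qed.

Lemma eGamma_ge0 x : 0 <= eGamma x.
Proof. by apply: integral_ge0 => t _; rewrite lee_fin gamma_fun_ge0. Qed.

Lemma GammaE x : Gamma x = fine (eGamma x).
Proof.
rewrite /Gamma /Rintegral /eGamma integral_mkcond; congr fine.
apply: eq_integral => t _; rewrite /gamma_fun patchE.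
by rewrite mem_setE in_itv/= andbT; case: ifP.
Qed.

Lemma eGamma_scaling (x c : R) : (0 < c)%R ->
  eGamma x * (c `^ (- x))%:E =
  \int[mu]_t (gamma_fun x t * expR ((1 - c) * t))%:E.
Proof.
move=> c0.
rewrite /eGamma (ge0_integral_affine 0%R (lt0r_neq0 c0)); first last.
- by move=> t; rewrite lee_fin gamma_fun_ge0.
- by apply/measurable_EFinP; exact: measurable_gamma_fun.
rewrite -muleA muleC -muleA -EFinM.
have mg : measurable_fun setT (fun t => (gamma_fun x (c * t + 0))%:E).
  apply/measurable_EFinP; apply: (measurableT_comp (measurable_gamma_fun x)).
  by apply: measurable_funD => //; exact: mulrl_measurable.
rewrite -ge0_integralZr//; first last.
- by rewrite lee_fin mulr_ge0// ?powR_ge0.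
- by move=> t _; rewrite lee_fin gamma_fun_ge0.
apply: eq_integral => t _; rewrite -EFinM addr0 /gamma_fun pmulr_rgt0//.
case: ifPn => [t0|]; last by rewrite !mul0r.
rewrite (gtr0_norm c0) powRM ?ltW//.
congr (_%:E).
transitivity (c `^ (x - 1) * c `^ (- x) * c * (t `^ (x - 1) * expR (- (c * t))))%R; first by ring.
rewrite -powRD; last by rewrite (gt_eqF c0) implybT.
rewrite (_ : x - 1 - x = - 1)%R; last by ring.
rewrite powR_inv1 ?ltW// mulVf ?gt_eqF// mul1r -mulrA -expRD; congr (_ * expR _)%R; ring.
Qed.

Lemma sine_powR (t : R) k : (sine t ^+ k = (1 + t ^+ 2) `^ (- (k%:R / 2)))%R.
Proof.
rewrite /sine; move: (1 + t ^+ 2)%R (one_sqr_gt0 t) => c c0.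
rewrite -powR12_sqrt ?ltW// exprVn -powR_mulrn ?powR_ge0// -powRrM powRN.
by rewrite [(_ / 2)%R]mulrC.
Qed.

Lemma integral_gauss_scaled (t : R) : (0 < t)%R ->
  \int[mu]_u (expR (- (t * u ^+ 2)))%:E = (t `^ (- 2^-1) * Num.sqrt pi)%:E.
Proof.
move=> t0.
have s0 : (0 < Num.sqrt t)%R by rewrite sqrtr_gt0.
have mg : measurable_fun setT (fun u : R => (gauss_fun u)%:E).
  by apply/measurable_EFinP; exact: measurable_gauss_fun.
have := ge0_integral_affine 0%R (lt0r_neq0 s0) mg (fun u => gauss_fun_ge0 u).
rewrite integralT_gauss (gtr0_norm s0) powRN powR12_sqrt ?(ltW t0)// EFinM => ->.
rewrite muleA -EFinM mulVf ?gt_eqF// mul1e.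
apply: eq_integral => u _.
by rewrite /gauss_fun addr0 exprMn sqr_sqrtr ?(ltW t0).
Qed.

Lemma eGamma_sine_mass k :
  eGamma (k.+2%:R / 2) * @sine_mass R k.+2 = (Num.sqrt pi)%:E * eGamma (k.+1%:R / 2).
Proof.
set x := (k.+2%:R / 2)%R.
pose F (u t : R) := (gamma_fun x t * expR (- (t * u ^+ 2)))%:E.
have mF : measurable_fun setT (fun p : R * R => F p.1 p.2).
  apply/measurable_EFinP; apply: measurable_funM.
    by apply: (measurableT_comp (measurable_gamma_fun x)).
  apply: measurableT_comp => //; apply: measurableT_comp => //.
  by apply: measurable_funM => //; apply: measurable_funX.
have F0 u t : 0 <= F u t by rewrite lee_fin mulr_ge0 ?gamma_fun_ge0 ?expR_ge0.
rewrite /sine_mass -ge0_integralZl//; first last.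
- exact: eGamma_ge0.
- by move=> u _; rewrite lee_fin exprn_ge0// ltW// sine_gt0.
- by apply/measurable_EFinP; apply: measurable_funX; exact: measurable_sine.
transitivity (\int[mu]_u \int[mu]_t F u t).
  apply: eq_integral => u _; rewrite sine_powR.
  apply: etrans; first exact: (eGamma_scaling x (one_sqr_gt0 u)).
  apply: eq_integral => t _; rewrite /F; congr (_ * expR _)%:E; ring.
apply: etrans; first exact: (tonelli_lebesgue mF F0).
rewrite /eGamma -ge0_integralZl//; first last.
- by move=> t _; rewrite lee_fin gamma_fun_ge0.
- by apply/measurable_EFinP; exact: measurable_gamma_fun.
apply: eq_integral => t _; rewrite /F.
under eq_integral do rewrite EFinM.
rewrite ge0_integralZl//; first last.
- by rewrite lee_fin gamma_fun_ge0.
- apply/measurable_EFinP; apply: measurableT_comp => //; apply: measurableT_comp => //.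
  by apply: measurable_funM => //; apply: measurable_funX.
rewrite /gamma_fun; case: ifPn => [t0|]; last by rewrite mul0e mule0.
rewrite integral_gauss_scaled// -!EFinM; congr _%:E.
rewrite mulrA mulrC; congr (_ * _)%R; rewrite mulrAC -powRD; last by rewrite (gt_eqF t0) implybT.
congr (_ `^ _ * _)%R; by rewrite /x -[in LHS]natr1; field.
Qed.

Lemma sine_mass2 : @sine_mass R 2 = pi%:E.
Proof.
rewrite /sine_mass ge0_symfun_integralT//=.
- rewrite (_ : [set x | _] = `[0%R, +oo[%classic); last first.
    by apply/seteqP; split => x/=; rewrite in_itv/= andbT.
  under eq_integral do rewrite sqr_sine.
  have -> := @integral0y_oneDsqr R.
  by rewrite -EFinM mulrCA divff// mulr1.
- by move=> t; rewrite exprn_ge0// ltW// sine_gt0.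
- by move=> t; apply: cvgM; exact: continuous_sine.
- by move=> t /=; rewrite /sine sqrrN.
Qed.

Lemma eGamma1 : eGamma 1 = 1.
Proof.
have -> : eGamma 1 = \int[mu]_t (exponential_pdf 1 t)%:E.
  apply: ge0_ae_eq_integral => //.
  - by apply/measurable_EFinP; exact: measurable_gamma_fun.
  - by apply/measurable_EFinP; exact: measurable_exponential_pdf.
  - by move=> t _; rewrite lee_fin gamma_fun_ge0.
  - by move=> t _; rewrite lee_fin exponential_pdf_ge0.
  exists [set (0%R : R)]; split => //; first exact: lebesgue_measure_set1.
  move=> t /= Ht; apply: contrapT => /eqP t0; apply: Ht => _.
  rewrite /gamma_fun; have [t_gt0|t_lt0|t_eq0] := ltgtP 0%R t.
  - by rewrite exponential_pdfE ?ltW//= subrr powRr0 !mul1r mulN1r.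
  - by rewrite lt0_exponential_pdf.
  - by rewrite -t_eq0 eqxx in t0.
exact: integral_exponential_pdf.
Qed.

Lemma sine_mass_ltpinfty k : @sine_mass R k.+2 < +oo.
Proof.
apply: (@le_lt_trans _ _ (@sine_mass R 2)); last by rewrite sine_mass2 ltry.
apply: ge0_le_integral => //.
- by move=> t _; rewrite lee_fin exprn_ge0// ltW// sine_gt0.
- by apply/measurable_EFinP; apply: measurable_funX; exact: measurable_sine.
- by apply/measurable_EFinP; apply: measurable_funX; exact: measurable_sine.
- move=> t _; rewrite lee_fin -addn2 exprD ler_piMl ?sqr_ge0//.
  by rewrite exprn_ile1 ?sine_le1// ltW// sine_gt0.
Qed.

Lemma eGamma_half k : 0 < eGamma (k.+1%:R / 2) < +oo.
Proof.
have sp0 : (0 < Num.sqrt (pi : R))%R by rewrite sqrtr_gt0 pi_gt0.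
elim: k => [|k /andP[IH0 IHy]].
  have := eGamma_sine_mass 0; rewrite sine_mass2 divff// eGamma1 mul1e => E.
  have : eGamma (1 / 2) != +oo.
    apply/eqP => H; move: E; rewrite H gt0_muley ?lte_fin//.
  have : eGamma (1 / 2) != 0.
    apply/eqP => H; move: E; rewrite H mule0 => -[] /eqP.
    by rewrite gt_eqF// pi_gt0.
  by rewrite ltey lt0e eGamma_ge0 => -> ->.
have E := eGamma_sine_mass k.
have P0 : 0 < (Num.sqrt pi)%:E * eGamma (k.+1%:R / 2) by rewrite mule_gt0// lte_fin.
have Py : (Num.sqrt pi)%:E * eGamma (k.+1%:R / 2) < +oo.
  by rewrite lte_mul_pinfty// lee_fin ltW.
rewrite -E in P0 Py.
have m0 : 0 <= @sine_mass R k.+2.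
  by apply: integral_ge0 => t _; rewrite lee_fin exprn_ge0// ltW// sine_gt0.
have mpos : 0 < @sine_mass R k.+2.
  rewrite lt0e m0 andbT; apply/eqP => H; by rewrite H mule0 ltxx in P0.
have gpos : 0 < eGamma (k.+2%:R / 2).
  rewrite lt0e eGamma_ge0 andbT; apply/eqP => H; by rewrite H mul0e ltxx in P0.
rewrite gpos/= ltey; apply/eqP => HG.
by rewrite HG gt0_mulye ?ltxx in Py.
Qed.

Lemma Gamma_half_gt0 k : (0 < Gamma (k.+1%:R / 2 : R))%R.
Proof. by rewrite GammaE fine_gt0// eGamma_half. Qed.

Lemma eGamma_halfE k : eGamma (k.+1%:R / 2) = (Gamma (k.+1%:R / 2))%:E.
Proof.
by have /andP[? ?] := eGamma_half k; rewrite GammaE fineK// ge0_fin_numE// eGamma_ge0.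
Qed.

Lemma Gamma1E : Gamma (1 : R) = 1%R.
Proof. by rewrite GammaE eGamma1. Qed.

Lemma sine_massE k :
  @sine_mass R k.+2 = (Gamma (k.+1%:R / 2) * Gamma (1 / 2) / Gamma (k.+2%:R / 2))%:E.
Proof.
have G1 := Gamma_half_gt0 k.+1; have G0 := Gamma_half_gt0 0.
have Hm j : exists M : R, @sine_mass R j.+2 = M%:E.
  exists (fine (@sine_mass R j.+2)); rewrite fineK// ge0_fin_numE ?sine_mass_ltpinfty//.
  by apply: integral_ge0 => t _; rewrite lee_fin exprn_ge0// ltW// sine_gt0.
have sp : (Num.sqrt (pi : R) ^+ 2 = pi)%R by rewrite sqr_sqrtr// ltW// pi_gt0.
have sp0 : (0 < Num.sqrt (pi : R))%R by rewrite sqrtr_gt0 pi_gt0.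
have Ghalf : Gamma (1 / 2 : R) = Num.sqrt (pi : R).
  have := eGamma_sine_mass 0; rewrite sine_mass2 !eGamma_halfE divff// Gamma1E mul1e.
  move=> -[] H; by apply: (mulfI (lt0r_neq0 sp0)); rewrite -H -expr2 sp.
have := eGamma_sine_mass k; have [M ->] := Hm k.
rewrite !eGamma_halfE -!EFinM => -[] H.
congr _%:E; apply: (mulIf (lt0r_neq0 G1)).
by rewrite divfK ?gt_eqF// [LHS]mulrC H mulrC Ghalf.
Qed.

End GammaBeta.

Section Cotangent.
Local Open Scope classical_set_scope.
Context {R : realType}.
Local Notation mu := (@lebesgue_measure R).
Implicit Types (t a b c : R).

Lemma is_derive_le (F G dF dG : R -> R) a b : a <= b ->
  (forall x, a <= x <= b -> is_derive x 1 F (dF x)) ->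
  (forall x, a <= x <= b -> is_derive x 1 G (dG x)) ->
  (forall x, a <= x <= b -> dF x <= dG x) ->
  F b - F a <= G b - G a.
Proof.
move=> ab dFP dGP dFG.
have dD x : a <= x <= b -> is_derive x 1 (G - F) (dG x - dF x).
  by move=> xab; apply: is_deriveB; [exact: dGP|exact: dFP].
have [||x xab E] := @MVT_segment R (G - F) (fun x => dG x - dF x) a b ab.
- by move=> x; rewrite in_itv/= => /andP[/ltW ? /ltW ?]; apply: dD; apply/andP.
- apply: derivable_within_continuous => x; rewrite in_itv/= => /dD dx.
  exact: ex_derive.
have : 0 <= (G - F) b - (G - F) a.
  by rewrite E mulr_ge0 ?subr_ge0//; apply: dFG.
by rewrite !fctE; lra.
Qed.

Lemma continuous_antiderivative (f : R -> R) : continuous f ->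
  exists2 F : R -> R, (forall x : R, 0 <= x -> is_derive x 1 F (f x)) &
  forall b, 0 <= b -> (\int[mu]_(x in `[0%R, b]) (f x)%:E)%E = (F b - F 0)%:E.
Proof.
move=> cf.
pose F (x : R) : R := (\int[mu]_(t in `[-1, x]) (f t))%R.
have dF (x : R) : 0 <= x -> is_derive x 1 F (f x).
  move=> x0; have x1 : -1 < x by rewrite (lt_le_trans _ x0)// ltrN10.
  have If : mu.-integrable `[-1, x + 1] (EFin \o f).
    apply: continuous_compact_integrable; first exact: segment_compact.
    exact: continuous_subspaceT.
  have xx1 : x < x + 1 by rewrite ltrDl.
  have [dFx Fx] := continuous_FTC1_closed xx1 If x1 (cf x).
  by apply: (DeriveDef dFx); rewrite -derive1E.
exists F => // b; rewrite le_eqVlt => /predU1P[<-|b0].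
  by rewrite set_itv1 integral_set1 subrr.
rewrite (@continuous_FTC2 R f F)//.
- exact: continuous_subspaceT.
- split.
  + by move=> x; rewrite in_itv/= => /andP[x0 _]; apply: ex_derive; exact: dF (ltW x0).
  + apply: cvg_at_right_filter; apply: differentiable_continuous.
    by apply/derivable1_diffP; apply: ex_derive; exact: dF.
  + apply: cvg_at_left_filter; apply: differentiable_continuous.
    by apply/derivable1_diffP; apply: ex_derive; exact: dF (ltW b0).
- move=> x; rewrite in_itv/= => /andP[x0 _].
  by rewrite derive1E; apply: derive_val; exact: dF (ltW x0).
Qed.

Definition cosine t := t * sine t.

Lemma is_derive_one_sqr t : is_derive t 1 (fun t => 1 + t ^+ 2) (2 * t).
Proof.
by apply: is_derive_eq; rewrite /GRing.scale/=; ring.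
Qed.

Lemma is_derive_sine t : is_derive t 1 (@sine R) (- t * sine t ^+ 3).
Proof.
have c0 := one_sqr_gt0 t; have s0 : 0 < Num.sqrt (1 + t ^+ 2) by rewrite sqrtr_gt0.
have ds : is_derive t 1 (fun t => Num.sqrt (1 + t ^+ 2)) ((2 * Num.sqrt (1 + t ^+ 2))^-1 * (2 * t)).
  exact: (@is_derive1_comp _ Num.sqrt (fun t => 1 + t ^+ 2) t _ _ (is_derive1_sqrt c0) (is_derive_one_sqr t)).
apply: (is_derive_eq (@is_deriveV _ (fun t => Num.sqrt (1 + t ^+ 2)) t _ _ (lt0r_neq0 s0) ds)).
rewrite /sine /GRing.scale/=; field; exact: lt0r_neq0.
Qed.

Lemma is_derive_cosine t : is_derive t 1 cosine (sine t ^+ 3).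
Proof.
have d := is_derive_sine t.
apply: (is_derive_eq (@is_deriveM _ _ (id : R -> R) (@sine R) t 1 _ _ (is_derive_id _ _) d)); rewrite /GRing.scale/=.
have c0 := one_sqr_gt0 t.
have -> : sine t * 1 = sine t ^+ 3 * (1 + t ^+ 2).
  by rewrite exprS sqr_sine mulr1 mulfVK// gt_eqF.
ring.
Qed.

Lemma is_derive_one_sqr_powR c t :
  is_derive t 1 (fun t => (1 + t ^+ 2) `^ c) (c * (1 + t ^+ 2) `^ (c - 1) * (2 * t)).
Proof.
exact: (@is_derive1_comp _ (@powR R ^~ c) (fun t => 1 + t ^+ 2) t _ _
  (is_derive1_powR c (one_sqr_gt0 t)) (is_derive_one_sqr t)).
Qed.

Lemma sineE t : sine t = (1 + t ^+ 2) `^ (- 2^-1).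
Proof. by rewrite powRN powR12_sqrt// ltW// one_sqr_gt0. Qed.

Lemma cosine0 : cosine 0 = 0. Proof. exact: mul0r. Qed.

Lemma sqr_cosine t : cosine t ^+ 2 = 1 - sine t ^+ 2.
Proof.
rewrite /cosine exprMn sqr_sine; have c0 := one_sqr_gt0 t.
by field; rewrite gt_eqF.
Qed.

Lemma cosine_lt1 t : cosine t < 1.
Proof.
have [c0|c0] := ltP 0 (cosine t); last exact: le_lt_trans c0 ltr01.
rewrite -(@expr_lt1 _ 2)// ?ltW// sqr_cosine ltrBlDr ltrDl exprn_gt0//.
exact: sine_gt0.
Qed.

Lemma cosine_ge0 t : 0 <= t -> 0 <= cosine t.
Proof. by move=> t0; rewrite mulr_ge0// ltW// sine_gt0. Qed.

Lemma cosine_le a b : a <= b -> cosine a <= cosine b.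
Proof.
move=> ab; rewrite -subr_ge0 -[leLHS](subrr 0).
apply: (@is_derive_le (cst 0) cosine (cst 0) (fun t => sine t ^+ 3) a b ab) => x _.
- exact: is_derive_cosine.
by rewrite exprn_ge0// ltW// sine_gt0.
Qed.


(* Upper bounds for J *)
Section Tail.
Variable p : R.
Hypothesis p0 : 0 < p.
Variable F : R -> R.
Hypothesis dF : forall x : R, 0 <= x -> is_derive x 1 F ((1 + x ^+ 2) `^ ((p - 1) / 2)).

Local Notation W := (fun t => (1 + t ^+ 2) `^ (p / 2)).

Lemma tail_le (h dh : R -> R) a b : 0 <= a -> a <= b ->
  (forall x, a <= x <= b -> is_derive (cosine x) 1 h (dh (cosine x))) ->
  (forall x, a <= x <= b ->
     p <= (1 - cosine x ^+ 2) * dh (cosine x) + p * cosine x * h (cosine x)) ->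
  p * (F b - F a) <= h (cosine b) * W b - h (cosine a) * W a.
Proof.
move=> a0 ab dhP hP.
rewrite mulrBr.
apply: (@is_derive_le (fun x => p * F x) (fun x => h (cosine x) * W x)
  (fun x => p * (1 + x ^+ 2) `^ ((p - 1) / 2))
  (fun x => h (cosine x) * ((p / 2) * (1 + x ^+ 2) `^ (p / 2 - 1) * (2 * x)) +
            W x * (dh (cosine x) * sine x ^+ 3))) => // x xab.
- have dFx := dF (le_trans a0 (andP xab).1).
  exact: (@is_deriveZ _ _ _ F p x 1 _ dFx).
- have dhx := @is_derive1_comp _ h cosine x _ _ (dhP x xab) (is_derive_cosine x).
  exact: (is_deriveM dhx (is_derive_one_sqr_powR (p / 2) x)).
have c0 := one_sqr_gt0 x; rewrite /=.
have -> : (1 + x ^+ 2) `^ (p / 2 - 1) = (1 + x ^+ 2) `^ ((p - 1) / 2) * sine x.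
  rewrite sineE -powRD ?(gt_eqF c0) ?implybT//; congr (_ `^ _); by field.
have -> : (1 + x ^+ 2) `^ (p / 2) = (1 + x ^+ 2) `^ ((p - 1) / 2) / sine x.
  rewrite sineE -powRN -powRD ?(gt_eqF c0) ?implybT//; congr (_ `^ _); by field.
have {}hP := hP x xab; rewrite sqr_cosine in hP.
have V0 : 0 <= (1 + x ^+ 2) `^ ((p - 1) / 2) by exact: powR_ge0.
set V := _ `^ _ in V0 *.
apply: le_trans (_ : V * ((1 - (1 - sine x ^+ 2)) * dh (cosine x) + p * cosine x * h (cosine x)) <= _).
  by rewrite mulrC ler_wpM2l.
rewrite /cosine; set s := sine x; have s0 : s != 0 by rewrite gt_eqF// sine_gt0.
rewrite le_eqVlt; apply/orP; left; apply/eqP; field.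
  exact: s0.
Qed.


Lemma W0 : W 0 = 1. Proof. by rewrite /= expr0n addr0 powR1. Qed.

Lemma W_gt0 t : 0 < W t. Proof. by rewrite powR_gt0// one_sqr_gt0. Qed.

Lemma tail_le_small b : p <= 1 -> 0 <= b -> p * (F b - F 0) <= cosine b * W b.
Proof.
move=> p1 b0.
have := @tail_le id (fun=> 1) 0 b (lexx _) b0 (fun x _ => is_derive_id _ _).
rewrite cosine0 mul0r subr0; apply=> x _.
have := sqr_ge0 (sine x); rewrite -[sine x ^+ 2](subKr 1) -sqr_cosine; nra.
Qed.

Lemma tail_le_linear b : 1 <= p -> 0 <= b -> p * (F b - F 0) <= p * cosine b * W b.
Proof.
move=> p1 b0.
have := @tail_le (fun t => p * t) (fun=> p) 0 b (lexx _) b0.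
rewrite cosine0 mulr0 mul0r subr0; apply=> x _.
  have := @is_deriveZ _ _ _ id p (cosine x) 1 _ (is_derive_id _ _).
  by rewrite /GRing.scale/= mulr1.
have := sqr_ge0 (cosine x); nra.
Qed.

Lemma exists_cosine t : 0 <= t < 1 -> exists2 x, 0 <= x & cosine x = t.
Proof.
move=> /andP[t0 t1].
have d0 : 0 < 1 - t ^+ 2 by rewrite subr_gt0 expr_lt1.
have sd0 : 0 < Num.sqrt (1 - t ^+ 2) by rewrite sqrtr_gt0.
exists (t / Num.sqrt (1 - t ^+ 2)); first by rewrite divr_ge0// ltW.
rewrite /cosine /sine expr_div_n sqr_sqrtr ?(ltW d0)//.
have -> : 1 + t ^+ 2 / (1 - t ^+ 2) = (1 - t ^+ 2)^-1 by field; rewrite gt_eqF.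
by rewrite sqrtrV ?(ltW d0)// invrK divfK// gt_eqF.
Qed.

Lemma tail_le_inv b : 1 <= p -> 0 <= b -> 0 < cosine b ->
  p * (F b - F 0) <= 2 / cosine b * W b.
Proof.
move=> p1 b0 cb0.
have [small|big] := leP (p * cosine b ^+ 2) 2.
  apply: le_trans (tail_le_linear p1 b0) _; rewrite ler_wpM2r ?powR_ge0//.
  by rewrite ler_pdivlMr// -mulrA -expr2.
(* switch from the linear bound where both agree *)
have c1 : 0 <= Num.sqrt (2 / p) < 1.
  rewrite sqrtr_ge0/=; have := cosine_lt1 b => cb1.
  have : cosine b ^+ 2 <= 1 by rewrite expr_le1 ?ltW.
  move=> cb2; rewrite -[ltRHS]sqrtr1 ltr_sqrt// ltr_pdivrMr// mul1r; nra.
have [a a0 ca] := exists_cosine c1.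
have ca2 : p * cosine a ^+ 2 = 2 by rewrite ca sqr_sqrtr ?divr_ge0 ?ltW// mulrC divfK ?gt_eqF.
have ca0 : 0 < cosine a by rewrite ca sqrtr_gt0 divr_gt0.
have ab : a <= b.
  rewrite leNgt; apply/negP => /ltW /cosine_le ba.
  have : cosine b ^+ 2 <= cosine a ^+ 2 by rewrite ler_pXn2r ?nnegrE ?(ltW ca0) ?(ltW cb0).
  by move=> H; have := ler_wpM2l (ltW p0) H; rewrite ca2 leNgt big.
have L1 := tail_le_linear p1 a0.
have L2 : p * (F b - F a) <= 2 / cosine b * W b - 2 / cosine a * W a.
  apply: (@tail_le (fun t => 2 / t) (fun t => 2 * - t ^- 2) a b a0 ab) => x /andP[ax xb].
    have cx0 : cosine x != 0 by rewrite gt_eqF// (lt_le_trans ca0)// cosine_le.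
    have dV := @is_deriveV _ id (cosine x) 1 1 cx0 (is_derive_id (cosine x : R) (1 : R)).
    have := @is_deriveZ _ _ _ (fun t : R => t^-1) 2 (cosine x) 1 _ dV.
    by rewrite /GRing.scale/= mulr1.
  have cax := cosine_le ax.
  have cx0 : 0 < cosine x by exact: lt_le_trans cax.
  have : cosine a ^+ 2 <= cosine x ^+ 2 by rewrite ler_pXn2r ?nnegrE ?(ltW ca0) ?(ltW cx0).
  move=> H; have := ler_wpM2l (ltW p0) H; rewrite ca2 => pc.
  rewrite [leRHS](_ : _ = 2 + 2 * p - 2 / cosine x ^+ 2); last by field; rewrite gt_eqF.
  have : 2 / cosine x ^+ 2 <= p by rewrite ler_pdivrMr ?exprn_gt0.
  lra.
have E : p * cosine a * W a = 2 / cosine a * W a.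
  by congr (_ * _); rewrite -ca2; field; rewrite gt_eqF.
by move: L1 L2; rewrite E; lra.
Qed.

Lemma tail_le_sqrt b : 1 <= p -> 0 <= b ->
  p * (F b - F 0) <= (1 + Num.sqrt (p * (1 - cosine b))) * W b.
Proof.
move=> p1 b0.
have S0 x : 0 <= p * (1 - cosine x).
  by rewrite mulr_ge0 ?(ltW p0)// subr_ge0 ltW// cosine_lt1.
have [small|big] := leP (p * cosine b) (1 + Num.sqrt (p * (1 - cosine b))).
  by apply: le_trans (tail_le_linear p1 b0) _; rewrite ler_wpM2r ?powR_ge0.
(* w ^ 2 + w = p - 1, so that p t = 1 + sqrt (p (1 - t)) for t = 1 - w ^ 2 / p *)
pose w := (Num.sqrt (4 * p - 3) - 1) / 2.
have w0 : 0 <= w.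
  rewrite divr_ge0// subr_ge0 -[leLHS]sqrtr1 ler_wsqrtr//; lra.
have wE : w ^+ 2 + w = p - 1.
  have := @sqr_sqrtr _ (4 * p - 3); rewrite /w; set u := Num.sqrt _ => H.
  have {}H : u ^+ 2 = 4 * p - 3 by apply: H; lra.
  rewrite [LHS](_ : _ = (u ^+ 2 - 1) / 4); last by field.
  by rewrite H; field.
have c1 : 0 <= 1 - w ^+ 2 / p <= 1.
  have : w ^+ 2 / p <= 1 by rewrite ler_pdivrMr// mul1r; lra.
  have : 0 <= w ^+ 2 / p by rewrite divr_ge0 ?sqr_ge0 ?ltW.
  lra.
have [w00|wn0] := eqVneq w 0.
  (* degenerate case p = 1 *)
  have p1' : p = 1 by move: wE; rewrite w00; lra.
  have : p * cosine b <= 1 by rewrite p1' mul1r ltW// cosine_lt1.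
  move=> H; exfalso; move: big; rewrite ltNge => /negP; apply.
  by rewrite (le_trans H)// lerDl sqrtr_ge0.
have c2 : 0 <= 1 - w ^+ 2 / p < 1.
  rewrite (andP c1).1/= ltrBlDr ltrDl divr_gt0// exprn_even_gt0//.
have [a a0 ca] := exists_cosine c2.
have pca : p * (1 - cosine a) = w ^+ 2 by rewrite ca; field; rewrite gt_eqF.
have pcaE : p * cosine a = 1 + Num.sqrt (p * (1 - cosine a)).
  rewrite pca sqrtr_sqr ger0_norm//; move: pca wE; lra.
have ab : a <= b.
  rewrite leNgt; apply/negP => /ltW /cosine_le ba.
  have : p * cosine b <= p * cosine a by rewrite ler_wpM2l// ltW.
  have : Num.sqrt (p * (1 - cosine a)) <= Num.sqrt (p * (1 - cosine b)).
    by rewrite ler_wsqrtr// ler_wpM2l ?(ltW p0)// lerB.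
  by move: big pcaE; lra.
have L1 := tail_le_linear p1 a0; rewrite pcaE in L1.
suff L2 : p * (F b - F a) <= (1 + Num.sqrt (p * (1 - cosine b))) * W b -
    (1 + Num.sqrt (p * (1 - cosine a))) * W a by move: L1 L2; lra.
apply: (@tail_le (fun t => 1 + Num.sqrt (p * (1 - t)))
   (fun t => (2 * Num.sqrt (p * (1 - t)))^-1 * - p) a b a0 ab) => x /andP[ax xb].
  have q0 : 0 < p * (1 - cosine x) by rewrite mulr_gt0// subr_gt0 cosine_lt1.
  have dl : is_derive (cosine x) 1 (fun t : R => p * (1 - t)) (- p).
    have d1 : is_derive (cosine x) 1 (cst 1 - id : R -> R) (0 - 1).
      by apply: is_deriveB.
    have := @is_deriveZ _ _ _ (cst 1 - id : R -> R) p (cosine x) 1 _ d1.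
    by rewrite /GRing.scale/= sub0r mulrN1.
  have ds := @is_derive1_comp _ Num.sqrt (fun t : R => p * (1 - t)) (cosine x) _ _
     (is_derive1_sqrt q0) dl.
  have := is_deriveD (is_derive_cst (1 : R) (cosine x : R) (1 : R)) ds.
  by rewrite add0r.
set c := cosine x; set S := Num.sqrt _.
have q0 : 0 < S by rewrite sqrtr_gt0 mulr_gt0// subr_gt0 cosine_lt1.
have SE : S ^+ 2 = p * (1 - c) by apply: sqr_sqrtr; exact: S0.
have cac : cosine a <= c by exact: cosine_le.
have Sle : S <= Num.sqrt (p * (1 - cosine a)).
  by rewrite ler_wsqrtr// ler_wpM2l ?(ltW p0)// lerB.
have pc : p * cosine a <= p * c by rewrite ler_wpM2l// ltW.
have c1' : c <= 1 by rewrite ltW// cosine_lt1.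
rewrite [leRHS](_ : _ = p * c * (1 + S) - (S ^+ 2 * (1 + c)) / (2 * S)); last first.
  by rewrite SE; field; rewrite gt_eqF.
rewrite [S ^+ 2]expr2 (_ : S * S * (1 + c) / (2 * S) = S * (1 + c) / 2); last first.
  by field; rewrite gt_eqF.
have key : 1 + S <= p * c by lra.
have pE : p = S ^+ 2 + p * c by rewrite SE; ring.
have k1 : 0 <= S * (p * c - 1 - S).
  by apply: mulr_ge0; [exact: ltW|move: key; lra].
have k2 : S * c <= S by rewrite ler_piMr// ltW.
move: k1 pE; rewrite expr2; lra.
Qed.

End Tail.
End Cotangent.

Section ZonalIntegral.
Local Open Scope classical_set_scope.
Context {R : realType}.
Local Notation mu := (@lebesgue_measure R).
Implicit Types (t a b c : R).

Lemma continuous_one_sqr_powR c : continuous (fun t : R => (1 + t ^+ 2) `^ c).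
Proof.
move=> t; have d := is_derive_one_sqr_powR c t.
by apply: differentiable_continuous; apply/derivable1_diffP; apply: ex_derive.
Qed.

Definition chord t : R := Num.sqrt (2 * (1 - cosine t)).

Lemma chord_gt0 t : 0 < chord t.
Proof. by rewrite sqrtr_gt0 mulr_gt0// subr_gt0 cosine_lt1. Qed.

Lemma sqr_chord t : chord t ^+ 2 = 2 * (1 - cosine t).
Proof. by rewrite sqr_sqrtr// mulr_ge0// subr_ge0 ltW// cosine_lt1. Qed.

Lemma is_derive_chord t : is_derive t 1 chord (- (sine t ^+ 3 / chord t)).
Proof.
have q0 : 0 < 2 * (1 - cosine t) by rewrite mulr_gt0// subr_gt0 cosine_lt1.
have d1 : is_derive t 1 (cst 1 - @cosine R : R -> R) (0 - sine t ^+ 3).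
  by apply: is_deriveB; exact: is_derive_cosine.
have d2 : is_derive t 1 (fun t => 2 * (1 - cosine t)) (2 * - sine t ^+ 3).
  by have := @is_deriveZ _ _ _ (cst 1 - @cosine R : R -> R) 2 t 1 _ d1; rewrite sub0r.
have := @is_derive1_comp _ Num.sqrt (fun t => 2 * (1 - cosine t)) t _ _ (is_derive1_sqrt q0) d2.
move/is_derive_eq; apply; rewrite -/(chord t); field.
by rewrite gt_eqF// chord_gt0.
Qed.

Lemma far_le k (C : R) (F dF : R -> R) a b : 0 <= C -> a <= b ->
  (forall x, a <= x <= b -> is_derive x 1 F (dF x)) ->
  (forall x, a <= x <= b -> dF x <= C * (chord x ^+ k * (sine x ^+ 3 / chord x))) ->
  F b - F a <= C * (chord a ^+ k.+1 / k.+1%:R).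
Proof.
move=> C0 ab dFP dFle.
apply: le_trans (_ : C * - (chord b ^+ k.+1 / k.+1%:R) - C * - (chord a ^+ k.+1 / k.+1%:R) <= _); last first.
  rewrite -mulrBr ler_wpM2l// opprK gerDr oppr_le0 divr_ge0// exprn_ge0// ltW//.
  exact: chord_gt0.
apply: (is_derive_le (G := fun x => C * - (chord x ^+ k.+1 / k.+1%:R)) ab dFP _ dFle) => x _.
have d1 := is_deriveX k.+1 (is_derive_chord x).
have d2 := @is_deriveZ _ _ _ _ (- (C / k.+1%:R)) x 1 _ d1.
have k0 : k.+1%:R != 0 :> R by rewrite pnatr_eq0.
have E : (fun y => C * - (chord y ^+ k.+1 / k.+1%:R)) = - (C / k.+1%:R) \*: chord ^+ k.+1.
  by apply/funext => y; rewrite /= exprfctE /GRing.scale/=; field.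
rewrite E; apply: (is_derive_eq d2); rewrite /GRing.scale/=.
by field; rewrite lt0r_neq0 ?chord_gt0//= nat1r.
Qed.

Lemma ge0_integral_sup_itv (f : R -> R) (M a : R) : continuous f -> (forall x, 0 <= f x) ->
  (forall b, a <= b -> ((\int[mu]_(x in `[0%R, b]) (f x)%:E)%E <= M%:E)%E) ->
  ((\int[mu]_(x in [set x | (0 <= x)%R]) (f x)%:E)%E <= M%:E)%E.
Proof.
move=> cf f0 H.
have mf : measurable_fun setT f by exact: continuous_measurable_fun.
rewrite (_ : [set x | _] = `[0%R, +oo[%classic); last first.
  by apply/seteqP; split => x/=; rewrite in_itv/= andbT.
have Hc := @ge0_cvgn_integral R mu _ f0 mf.
rewrite -(cvg_lim _ Hc)//; apply: lime_le; first by apply/cvg_ex; eexists; exact: Hc.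
near=> n; apply: H.
by near: n; exact: nbhs_infty_ger.
Unshelve. all: by end_near. Qed.

Variables (k : nat) (s a : R).
Local Notation m := (k.+1%:R : R).
Hypothesis s_gt : m < s.
Hypothesis a0 : 0 <= a.
Local Notation rho := (sine a).
Local Notation p := (s - m).

Definition truncated (r q : R) : R := Num.min 1 (r `^ s * q `^ (- (s / 2))).

Lemma truncated_ge0 r q : 0 <= truncated r q.
Proof. by rewrite le_min ler01 mulr_ge0// powR_ge0. Qed.

Lemma measurable_truncated r : measurable_fun setT (truncated r).
Proof.
by apply: measurable_minr => //; apply: measurable_funM => //; exact: measurable_powR.
Qed.

Let f t := truncated rho (sine t ^+ 2) * sine t ^+ k.+2.

Let fE t : f t = Num.min 1 (rho `^ s * (1 + t ^+ 2) `^ (s / 2)) * sine t ^+ k.+2.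
Proof.
by rewrite /f /truncated sqr_sine -powR_inv1 ?ltW ?one_sqr_gt0// -powRrM mulN1r opprK.
Qed.

Let cf : continuous f.
Proof.
rewrite (_ : f = fun t => Num.min 1 (rho `^ s * (1 + t ^+ 2) `^ (s / 2)) * sine t ^+ k.+2); last first.
  by apply/funext => t; exact: fE.
move=> t; apply: cvgM; last first.
  apply: (@continuous_comp _ _ _ (@sine R) (fun x => x ^+ k.+2)).
    exact: continuous_sine.
  exact: exprn_continuous.
apply: (@continuous_min R R (cst 1) (fun t => rho `^ s * (1 + t ^+ 2) `^ (s / 2)) t); first exact: cvg_cst.
by apply: cvgM; [exact: cvg_cst|exact: continuous_one_sqr_powR].
Qed.

Lemma zonal_integral_le (H C : R) : 0 <= C ->
  (forall F : R -> R,
    (forall x : R, 0 <= x -> is_derive x 1 F ((1 + x ^+ 2) `^ ((p - 1) / 2))) ->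
    p * (F a - F 0) <= H * (1 + a ^+ 2) `^ (p / 2)) ->
  (forall x, a <= x -> sine x ^+ k.+2 <= C * (chord x ^+ k * (sine x ^+ 3 / chord x))) ->
  (\int[mu]_t ((truncated rho (sine t ^+ 2))%:E * (sine t ^+ k.+2)%:E) <=
   (2 * (rho ^+ k.+1 * H / p + C * (chord a ^+ k.+1 / m)))%:E)%E.
Proof.
move=> C0 HP CP.
have p0 : 0 < p by rewrite subr_gt0.
have rho0 : 0 < rho by exact: sine_gt0.
have [F dF FE] := continuous_antiderivative cf.
have [Fp dFp _] := continuous_antiderivative (f := fun x => (1 + x ^+ 2) `^ ((p - 1) / 2))
   (@continuous_one_sqr_powR _).
have near : F a - F 0 <= rho ^+ k.+1 * H / p.
  apply: le_trans (_ : rho `^ s * Fp a - rho `^ s * Fp 0 <= _).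
    apply: (is_derive_le (F := F) (G := fun x => rho `^ s * Fp x)
      (dG := fun x => rho `^ s * (1 + x ^+ 2) `^ ((p - 1) / 2)) a0) => x /andP[x0 xa].
    - exact: dF.
    - exact: (@is_deriveZ _ _ _ Fp (rho `^ s) x 1 _ (dFp x x0)).
    rewrite fE; apply: le_trans (_ : (rho `^ s * (1 + x ^+ 2) `^ (s / 2)) * sine x ^+ k.+2 <= _).
      by rewrite ler_wpM2r ?exprn_ge0 ?(ltW (sine_gt0 _))// ge_min lexx orbT.
    rewrite sine_powR -mulrA -powRD ?(gt_eqF (one_sqr_gt0 x)) ?implybT//.
    rewrite (_ : s / 2 + - (k.+2%:R / 2) = (p - 1) / 2)//.
    by rewrite -[k.+2%:R]natr1; field.
  have c0 := one_sqr_gt0 a.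
  rewrite -mulrBr ler_pdivlMr// -mulrA [_ * p]mulrC.
  apply: le_trans (_ : rho `^ s * (H * (1 + a ^+ 2) `^ (p / 2)) <= _).
    by rewrite ler_wpM2l ?powR_ge0//; exact: HP.
  rewrite mulrCA [_ * H]mulrC sine_powR sineE -powRrM -powRD ?(gt_eqF c0) ?implybT//.
  by rewrite (_ : - 2^-1 * s + p / 2 = - (m / 2))//; field.
have tot b : a <= b -> ((\int[mu]_(x in `[0%R, b]) (f x)%:E)%E <=
    (rho ^+ k.+1 * H / p + C * (chord a ^+ k.+1 / m))%:E)%E.
  move=> ab; rewrite FE ?(le_trans a0)// lee_fin.
  rewrite -(subrK (F a) (F b)) -addrA addrC lerD//.
  apply: (far_le (dF := f)) => // x /andP[ax xb]; first exact: dF (le_trans a0 ax).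
  apply: le_trans (CP x ax); rewrite fE ler_piMl ?exprn_ge0 ?(ltW (sine_gt0 _))//.
have f0 x : 0 <= f x by rewrite mulr_ge0 ?truncated_ge0// exprn_ge0// ltW// sine_gt0.
under eq_integral do rewrite -EFinM.
rewrite ge0_symfun_integralT//; last first.
  by move=> t; rewrite /= /sine sqrrN.
by rewrite [leRHS]EFinM lee_wpmul2l// ?lee_fin//; exact: (ge0_integral_sup_itv cf f0 tot).
Qed.
End ZonalIntegral.

Section PowerEstimates.
Context {R : realType}.
Implicit Types (x y z w sg : R).

Lemma ln_ge_pade x : 1 <= x -> 2 * (x - 1) / (x + 1) <= ln x.
Proof.
move=> x1.
have := @is_derive_le R (fun x => 2 + -4 * (x + 1)^-1) (@ln R) (fun x => 4 / (x + 1) ^+ 2) (fun x => x^-1) 1 x x1.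
rewrite ln1 subr0 => H; apply: le_trans (H _ _ _).
- by rewrite le_eqVlt; apply/orP; left; apply/eqP; field; rewrite gt_eqF//; lra.
- move=> y /andP[y1 _]; have y0 : y + 1 != 0 by rewrite gt_eqF//; lra.
  have d1 : is_derive y 1 (id + cst 1 : R -> R) (1 + 0) by apply: is_deriveD.
  have d2 := @is_deriveV _ (fun y : R => y + 1) y _ 1 y0 d1.
  have d3 := @is_deriveZ _ _ _ (fun y : R => (y + 1)^-1) (- 4) y 1 _ d2.
  apply: (is_derive_eq (is_deriveD (is_derive_cst (2 : R) (y : R) (1 : R)) d3)).
  by rewrite /GRing.scale/=; field; exact: y0.
- by move=> y /andP[y1 _]; apply: is_derive1_ln; lra.
- move=> y /andP[y1 _]; have y0 : 0 < y by lra.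
  have y10 : 0 < y + 1 by lra.
  rewrite ler_pdivrMr ?exprn_gt0// mulrC ler_pdivlMr//.
  have := sqr_ge0 (y - 1); rewrite !expr2; lra.
Qed.

Lemma expR_ge_quadratic y : 0 <= y -> 1 + y + y ^+ 2 / 2 <= expR y.
Proof.
move=> y0.
have H := @is_derive_le R (fun y => y + 2^-1 * y ^+ 2) (@expR R) (fun y => 1 + y) (@expR R) 0 y y0.
have : y + 2^-1 * y ^+ 2 - (0 + 2^-1 * 0 ^+ 2) <= expR y - expR 0.
  apply: H => u _.
  - have d1 := @is_deriveX _ _ id 2 u 1 _ (is_derive_id (u : R) (1 : R)).
    have d2 := @is_deriveZ _ _ _ _ 2^-1 u 1 _ d1.
    have d3 := is_deriveD (is_derive_id (u : R) (1 : R)) d2.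
    have E : (fun y : R => y + 2^-1 * y ^+ 2) = id + 2^-1 \*: (id : R -> R) ^+ 2.
      by apply/funext => v; rewrite fctE /= exprfctE.
    rewrite E; apply: (is_derive_eq d3).
    by rewrite /GRing.scale/= !expr1; field.
  - exact: expR_ge1Dx.
by rewrite expR0 expr0n/=; lra.
Qed.

Lemma ln_17_2 : 23 / 11 <= ln (17 / 2 : R).
Proof.
have p1 : 2 / 5 <= ln (3 / 2) :> R.
  by apply: le_trans (@ln_ge_pade (3 / 2) ltac:(lra)); rewrite ler_pdivlMr; lra.
have p2 : 2 / 21 <= ln (11 / 10) :> R.
  by apply: le_trans (@ln_ge_pade (11 / 10) ltac:(lra)); rewrite ler_pdivlMr; lra.
have : ln ((3 / 2) ^+ 5 * (11 / 10) : R) <= ln (17 / 2).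
  by rewrite ler_ln ?posrE//; rewrite ?exprS ?expr0; lra.
rewrite lnM ?posrE ?exprn_gt0//.
rewrite lnXn; [|lra].
rewrite -[ln _ *+ 5]mulr_natl; move: p1 p2; lra.
Qed.

Lemma ln_quadratic_ge w : 0 <= w -> w <= 16 / 7 ->
  120 / 133 * w <= ln (1 + w + w ^+ 2).
Proof.
move=> w0 wle; set c : R := 120 / 133.
have q0 (u : R) : 0 <= u -> 0 < 1 + u + u ^+ 2.
  by move=> u0; have := sqr_ge0 u; rewrite expr2; lra.
have dl (u : R) : 0 <= u -> is_derive u 1 (fun u => ln (1 + u + u ^+ 2)) ((1 + u + u ^+ 2)^-1 * (1 + 2 * u)).
  move=> u0.
  have d1 : is_derive u 1 (fun u => 1 + u + u ^+ 2 : R) (1 + 2 * u).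
    by apply: is_derive_eq; rewrite /GRing.scale/=; ring.
  exact: (@is_derive1_comp _ (@ln R) (fun u => 1 + u + u ^+ 2) u _ _ (is_derive1_ln (q0 u u0)) d1).
have dc (u : R) : is_derive u 1 (fun u => c * u) c.
  have := @is_deriveZ _ _ _ id c u 1 _ (is_derive_id (u : R) (1 : R)).
  by rewrite /GRing.scale/= mulr1.
have [w13|w13] := leP w (13 / 10).
  have := @is_derive_le R _ _ (fun=> c) _ 0 w w0 (fun u _ => dc u) (fun u H => dl u (andP H).1) _.
  rewrite !(addr0, mulr0, subr0, expr0n)/= ?addr0 ln1 subr0; apply => u /andP[u0 uw].
  rewrite mulrC ler_pdivlMr ?q0// /c.
  have : 0 <= u * (13 / 10 - u) by rewrite mulr_ge0//; lra.
  rewrite expr2; lra.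
have := @is_derive_le R _ _ _ (fun=> c) w (16 / 7) wle
  (fun u H => dl u (le_trans w0 (andP H).1)) (fun u _ => dc u) _.
have : ln (17 / 2) <= ln (1 + 16 / 7 + (16 / 7) ^+ 2) :> R.
  by rewrite ler_ln ?posrE ?expr2; lra.
have := ln_17_2; rewrite /c => h1 h2 h3.
suff : ln (1 + 16 / 7 + (16 / 7) ^+ 2) - ln (1 + w + w ^+ 2)
  <= 120 / 133 * (16 / 7) - 120 / 133 * w by lra.
apply: h3 => u /andP[u0 uw].
rewrite mulrC ler_pdivrMr; last by apply: q0; lra.
have : 0 <= (u - 13 / 10) * u by rewrite mulr_ge0//; lra.
rewrite expr2; lra.
Qed.

Definition power_excess sg := sg * (sg `^ sg^-1 - 1).

Lemma power_excess_ge sg : 1 <= sg -> ln sg + ln sg ^+ 2 / (2 * sg) <= power_excess sg.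
Proof.
move=> s1; have s0 : 0 < sg by lra.
have L0 : 0 <= ln sg by rewrite ln_ge0.
rewrite /power_excess /powR gt_eqF// [sg^-1 * _]mulrC.
have := @expR_ge_quadratic (ln sg / sg) (divr_ge0 L0 (ltW s0)).
rewrite -subr_ge0 => /(mulr_ge0 (ltW s0)) H; rewrite -subr_ge0; apply: le_trans H _.
rewrite le_eqVlt; apply/orP; left; apply/eqP; field; exact: lt0r_neq0.
Qed.

Lemma power_excess_ge_ln sg : 1 <= sg -> ln sg <= power_excess sg.
Proof.
move=> s1; apply: le_trans (power_excess_ge s1).
by rewrite lerDl divr_ge0 ?sqr_ge0//; lra.
Qed.

Lemma power_excess_large z : 15 / 2 <= z -> 34 / 11 <= 1 + power_excess (1 + z).
Proof.
move=> z1; have s1 : 1 <= 1 + z by lra.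
have := power_excess_ge_ln s1; have := ln_17_2.
have : ln (17 / 2) <= ln (1 + z) by rewrite ler_ln ?posrE//; lra.
lra.
Qed.

Lemma power_excess_small z : 0 <= z -> z <= 15 / 2 ->
  z <= power_excess (1 + z) * (1 + power_excess (1 + z)).
Proof.
move=> z0 zle; have s1 : 1 <= 1 + z by lra.
have H1 := power_excess_ge s1; have H2 := power_excess_ge_ln s1.
set f := power_excess _ in H1 H2 *.
have mono g : 0 <= g -> g <= f -> g * (1 + g) <= f * (1 + f).
  by move=> g0 gf; apply: ler_pM => //; lra.
have [z2|z2] := leP z 2.
  have := ln_ge_pade s1; rewrite addrAC subrr add0r => H3.
  have g0 : 0 <= 2 * z / (1 + z + 1) by rewrite divr_ge0//; lra.
  apply: le_trans (mono _ g0 (le_trans H3 H2)).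
  rewrite -subr_ge0 (_ : _ - z = z ^+ 2 * (2 - z) / (1 + z + 1) ^+ 2).
    by rewrite divr_ge0 ?mulr_ge0 ?sqr_ge0//; lra.
  by field; rewrite gt_eqF//; lra.
pose w := (Num.sqrt (1 + 4 * z) - 1) / 2.
have Sq : Num.sqrt (1 + 4 * z) ^+ 2 = 1 + 4 * z by rewrite sqr_sqrtr//; lra.
have S3 : 3 <= Num.sqrt (1 + 4 * z).
  by rewrite -(@ler_pXn2r _ 2) ?nnegrE ?sqrtr_ge0// Sq expr2; lra.
have S5 : Num.sqrt (1 + 4 * z) <= 39 / 7.
  by rewrite -(@ler_pXn2r _ 2) ?nnegrE ?sqrtr_ge0// Sq expr2; lra.
have wz : w * (1 + w) = z by move: Sq; rewrite /w !expr2; lra.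
have w1 : 1 <= w by rewrite /w; lra.
have w2 : w <= 16 / 7 by rewrite /w; lra.
rewrite -[leLHS]wz; apply: mono; first lra.
apply: le_trans H1.
have := @ln_quadratic_ge w ltac:(lra) w2.
have -> : 1 + w + w ^+ 2 = 1 + z by rewrite -wz; ring.
set L := ln _ => HL.
apply: le_trans (_ : 120 / 133 * w + (120 / 133 * w) ^+ 2 / (2 * (1 + z)) <= _); last first.
  rewrite lerD// ler_wpM2r ?invr_ge0//; first lra.
  by rewrite ler_pXn2r ?nnegrE//; lra.
rewrite -lerBlDl ler_pdivlMr; last lra.
rewrite -wz.
have k : 0 <= (w - 1) * (16 / 7 - w) by rewrite mulr_ge0//; lra.
suff : 0 <= w * ((120 / 133) ^+ 2 * w - 13 / 133 * (2 * (1 + w * (1 + w)))) by rewrite !expr2; lra.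
apply: mulr_ge0; first lra.
rewrite expr2; move: k; lra.
Qed.

End PowerEstimates.

Section ChordRatio.
Context {R : realType}.
Implicit Types (t w y z f A : R).

Lemma bernoulli x n : 0 <= x :> R -> 1 + n%:R * x <= (1 + x) ^+ n.
Proof.
move=> x0; elim: n => [|n IH]; first by rewrite mul0r addr0 expr0.
rewrite exprSr; apply: le_trans (ler_wpM2r _ IH); last lra.
have : 0 <= n%:R * x * x by rewrite !mulr_ge0.
rewrite -natr1; lra.
Qed.

Lemma bernoulli_half w n : 0 <= w -> (2 <= n)%N ->
  (1 + n%:R / 2 * w) ^+ 2 <= (1 + w) ^+ n.
Proof.
move=> w0; elim: n => // n IH; rewrite leq_eqVlt => /predU1P[[<-]|n2].
  by rewrite divff ?mul1r// pnatr_eq0.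
rewrite [in leRHS]exprSr; apply: le_trans (ler_wpM2r _ (IH n2)); last lra.
have n2R : 2 <= n%:R :> R by rewrite ler_nat.
rewrite -natr1; set u := n%:R / 2 * w; set N : R := n%:R in u n2R *.
have uw : w <= u by rewrite /u -[leLHS]mul1r ler_wpM2r//; lra.
have -> : (N + 1) / 2 * w = u + w / 2 by rewrite /u; field.
have : 0 <= w * ((1 + u) * u - w / 4).
  rewrite mulr_ge0// subr_ge0; have : 0 <= u * u by rewrite mulr_ge0; lra.
  lra.
rewrite !expr2; lra.
Qed.

Variables (t y : R).
Hypotheses (t0 : 0 <= t) (t1 : t <= 1) (y0 : 0 <= y) (yE : y ^+ 2 * (1 + t) = 2).

Let yE' : y ^+ 2 = 2 / (1 + t).
Proof. rewrite -yE mulfK// gt_eqF//. move: t0; lra. Qed.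

Lemma chord_ratio_ge1 : 1 <= y.
Proof.
have [t0' t1'] := (t0, t1).
rewrite -(@ler_pXn2r _ 2) ?nnegrE// expr1n yE' ler_pdivlMr; lra.
Qed.

Lemma chord_ratio_ge : 1 + (1 - t) / 4 <= y.
Proof.
have [t0' t1'] := (t0, t1).
rewrite -(@ler_pXn2r _ 2) ?nnegrE//; last lra.
rewrite yE' ler_pdivlMr; last lra.
have : 0 <= (1 - t) ^+ 2 * (6 + (1 - t)) by rewrite mulr_ge0 ?sqr_ge0//; lra.
rewrite !expr2; lra.
Qed.

Lemma sqrt_tail_le m z f : 0 <= z -> 0 <= f -> z <= f * (1 + f) ->
  1 + Num.sqrt (z * m%:R * (1 - t)) <= y ^+ m * (1 + f).
Proof.
have [t0' t1'] := (t0, t1).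
move=> z0 f0 zf; set q := (1 - t) / 4; set M : R := m%:R.
have q0 : 0 <= q by rewrite /q; lra.
have M0 : 0 <= M by [].
have Mq : 0 <= M * q by rewrite mulr_ge0.
apply: le_trans (_ : (1 + M * q) * (1 + f) <= _); last first.
  rewrite ler_wpM2r//; first lra.
  apply: le_trans (bernoulli m q0) _.
  by rewrite lerXn2r ?nnegrE//; [lra|exact: chord_ratio_ge].
suff : Num.sqrt (z * M * (1 - t)) <= f + M * q * (1 + f) by lra.
have b0 : 0 <= f + M * q * (1 + f) by rewrite addr_ge0// mulr_ge0//; lra.
rewrite -(ger0_norm b0) -sqrtr_sqr ler_wsqrtr//.
have -> : z * M * (1 - t) = 4 * (M * q) * z by rewrite /q; field.
apply: le_trans (_ : 4 * (M * q) * (f * (1 + f)) <= _).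
  by rewrite ler_wpM2l// mulr_ge0.
have := sqr_ge0 (f - M * q * (1 + f)); rewrite !expr2; lra.
Qed.

Lemma expR1_le3 : expR 1 <= 3 :> R.
Proof.
have [t0' t1'] := (t0, t1).
have -> : 1 = 6%:R * 6^-1 :> R by rewrite divff// pnatr_eq0.
rewrite expRM_natl.
have H : expR 6^-1 <= 6 / 5 :> R.
  have h : 5 / 6 <= expR (- 6^-1) :> R by apply: le_trans (expR_ge1Dx _); lra.
  rewrite -[expR _]invrK -expRN (_ : 6 / 5 = (5 / 6)^-1); last by field.
  by rewrite lef_pV2 ?posrE ?expR_gt0.
apply: le_trans (_ : (6 / 5) ^+ 6 <= _).
  by rewrite lerXn2r ?nnegrE ?expR_ge0//; lra.
rewrite !exprS expr0; lra.
Qed.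

(* the exponent is forced to be large *)
Lemma exponent_gt m (l : nat) : 0 < t -> t < 1 ->
  (1 - t) ^+ m * 3 ^+ l < 1 -> l%:R * (1 - t) < m%:R * t.
Proof.
have [t0' t1'] := (t0, t1).
move=> tp tlt small.
have u0 : 0 < 1 - t by lra.
rewrite ltNge; apply/negP => H; move: small; rewrite ltNge => /negP; apply.
have E1 : expR (- (t / (1 - t))) <= 1 - t.
  rewrite expRN -[leRHS]invrK lef_pV2 ?posrE ?expR_gt0 ?invr_gt0//.
  apply: le_trans (expR_ge1Dx _); rewrite le_eqVlt; apply/orP; left; apply/eqP.
  by field; rewrite gt_eqF.
have E2 : expR l%:R <= 3 ^+ l :> R.
  by rewrite -[l%:R]mulr1 expRM_natl lerXn2r ?nnegrE ?expR_ge0// expR1_le3.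
apply: le_trans (_ : expR (- (t / (1 - t))) ^+ m * expR l%:R <= _); last first.
  apply: ler_pM => //; rewrite ?exprn_ge0 ?expR_ge0//.
  by rewrite lerXn2r ?nnegrE ?expR_ge0// ltW.
rewrite -expRM_natl -expRD -[leLHS]expR0 ler_expR mulrN addrC subr_ge0 mulrA ler_pdivrMr//.
Qed.

Lemma inv_tail_le m N A : 34 / 11 <= A -> (2 <= m)%N -> (2 <= N)%N -> 0 < t -> t < 1 ->
  (1 - t) ^+ m * N%:R ^+ 2 < 1 ->
  (N%:R - 1) * (2 / t) <= N%:R * (y ^+ m * A).
Proof.
have [t0' t1'] := (t0, t1).
move=> A3 m2 N2 tp tlt small.
have w0 : 0 <= (1 - t) / (1 + t) by rewrite divr_ge0; lra.
have yw : 1 + m%:R / 2 * ((1 - t) / (1 + t)) <= y ^+ m.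
  rewrite -(@ler_pXn2r _ 2) ?nnegrE ?exprn_ge0//; last first.
    by rewrite addr_ge0// mulr_ge0// divr_ge0.
  rewrite exprAC yE' (_ : 2 / (1 + t) = 1 + (1 - t) / (1 + t)); last by field; lra.
  exact: bernoulli_half.
have key (l : nat) (c : R) : (1 - t) ^+ m * 3 ^+ l < 1 -> 
    c * (1 + t) <= (34 / 11) * (t * (1 + t) + l%:R / 2 * (1 - t) ^+ 2) -> c / t <= y ^+ m * A.
  move=> sm H; have lm := exponent_gt tp tlt sm.
  rewrite ler_pdivrMr//.
  apply: le_trans (_ : (34 / 11) * (1 + m%:R / 2 * ((1 - t) / (1 + t))) * t <= _); last first.
    rewrite ler_wpM2r// mulrC; apply: ler_pM => //.
    by rewrite addr_ge0// mulr_ge0// divr_ge0.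
  rewrite (_ : _ * t = (34 / 11) * (t * (1 + t) + m%:R * t / 2 * (1 - t)) / (1 + t)); last first.
    by field; lra.
  rewrite ler_pdivlMr; last lra.
  apply: le_trans H _; rewrite ler_wpM2l ?lerD2l//.
  have : 0 <= (m%:R * t - l%:R * (1 - t)) * (1 - t) by rewrite mulr_ge0//; lra.
  rewrite expr2; lra.
have small' (l : nat) : 3 ^+ l <= N%:R ^+ 2 :> R -> (1 - t) ^+ m * 3 ^+ l < 1.
  move=> H; apply: le_lt_trans small; rewrite ler_wpM2l// exprn_ge0//; lra.
move: N2 small'; rewrite leq_eqVlt => /predU1P[<- small'|N3 small'].
  rewrite (_ : 2%:R - 1 = 1 :> R); last lra.
  rewrite mul1r -[t^-1]mul1r ler_wpM2l//; apply: (key 1%N).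
    by apply: small'; rewrite expr1 expr2; lra.
  by have := sqr_ge0 (t - 1 / 9); rewrite !expr2; lra.
have N3R : 3 <= N%:R :> R by rewrite ler_nat.
apply: le_trans (_ : N%:R * (2 / t) <= _).
  by rewrite ler_wpM2r ?divr_ge0//; lra.
rewrite ler_wpM2l//; apply: (key 2%N).
  by apply: small'; rewrite lerXn2r ?nnegrE.
have := sqr_ge0 (t - 7 / 17); rewrite !expr2; lra.
Qed.

Lemma inv_tail_le1 N A : 34 / 11 <= A -> (2 <= N)%N -> 1 - t <= 2 / N%:R ^+ 2 ->
  (N%:R - 1) * (2 / t) <= N%:R * (y * A).
Proof.
have [t0' t1'] := (t0, t1).
move=> A3 N2 tN.
have yA : 34 / 11 <= y * A.
  apply: le_trans (A3) _; rewrite ler_peMl ?chord_ratio_ge1//.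
  by apply: le_trans A3.
move: N2 tN; rewrite leq_eqVlt => /predU1P[<- |N3] tN.
  rewrite (_ : 2%:R - 1 = 1 :> R); last lra.
  have t2 : 1 / 2 <= t by move: tN; rewrite expr2; lra.
  rewrite mul1r ler_pdivrMr; last lra.
  apply: le_trans (_ : 2 * (34 / 11) * t <= _); first lra.
  by rewrite ler_wpM2r//; lra.
have N3R : 3 <= N%:R :> R by rewrite ler_nat.
have t2 : 7 / 9 <= t.
  suff : 2 / N%:R ^+ 2 <= 2 / 9 :> R by move: tN; lra.
  rewrite ler_wpM2l// lef_pV2 ?posrE ?exprn_gt0 ?ltr0n//; last by case: (N) N3.
  by rewrite expr2; have := ler_pM (ler0n R 3) (ler0n R 3) N3R N3R; lra.
apply: ler_pM; [lra|rewrite divr_ge0//|lra|].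
apply: le_trans yA; rewrite ler_pdivrMr; lra.
Qed.

Lemma chord_ratio_lt N : (2 <= N)%N -> 1 - t <= 2 / N%:R ^+ 2 ->
  (N%:R - 1) * y < N%:R.
Proof.
have [t0' t1'] := (t0, t1).
move=> N2 tN; have N2R : 2 <= N%:R :> R by rewrite ler_nat.
rewrite -(@ltr_pXn2r _ 2) ?nnegrE//; last by rewrite mulr_ge0//; lra.
rewrite exprMn yE' mulrA ltr_pdivrMr; last lra.
set n : R := N%:R in N2R tN *.
have tn : (1 - t) * n ^+ 2 <= 2 by rewrite -ler_pdivlMr// exprn_gt0//; lra.
move: tn; rewrite !expr2; lra.
Qed.

End ChordRatio.

Section SineChord.
Context {R : realType}.

Lemma sine_le_chord (x : R) : sine x <= chord x.
Proof.
rewrite -(@ler_pXn2r _ 2) ?nnegrE ?(ltW (sine_gt0 _)) ?(ltW (chord_gt0 _))//.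
rewrite sqr_chord -[sine x ^+ 2](subKr 1) -sqr_cosine.
have := sqr_ge0 (1 - cosine x); rewrite !expr2; lra.
Qed.

Lemma sineX_le_chord k (x : R) :
  sine x ^+ k.+3 <= chord x ^+ k.+1 * (sine x ^+ 3 / chord x).
Proof.
rewrite [chord x ^+ _]exprSr -mulrA (mulrCA (chord x)) divff ?lt0r_neq0 ?chord_gt0// mulr1.
rewrite -[k.+3]addn3 exprD ler_wpM2r ?exprn_ge0 ?(ltW (sine_gt0 _))//.
by rewrite lerXn2r ?nnegrE ?(ltW (sine_gt0 _)) ?(ltW (chord_gt0 _))// sine_le_chord.
Qed.

End SineChord.

Section ZonalBound.
Context {R : realType}.
Local Notation mu := (@lebesgue_measure R).
Variables (k : nat) (s : R).
Local Notation m := (k.+1%:R : R).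
Local Notation p := (s - m).
Hypothesis s_gt : m < s.
Local Notation A := (1 + power_excess (1 + p / m)).
Local Notation C2 := (C2real k.+2 s).

Lemma exists_sine_mass : exists2 I : R, @sine_mass R k.+2 = I%:E &
  I = Gamma (k.+1%:R / 2) * Gamma (1 / 2) / Gamma (k.+2%:R / 2).
Proof. by eexists; [exact: sine_massE|]. Qed.

Lemma C2real_gt0 : 0 < C2.
Proof.
have m0 : 0 < m by [].
have s0 : 0 < s by apply: lt_trans s_gt.
have E : k.+2%:R - 1 = m :> R by rewrite -natr1 addrK.
have G1 := @Gamma_half_gt0 R k; have G2 := @Gamma_half_gt0 R k.+1; have G0 := @Gamma_half_gt0 R 0.
rewrite /C2real (_ : s - k.+2%:R + 1 = p); last by rewrite -[k.+2%:R]natr1; ring.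
rewrite E mulr_gt0 ?powR_gt0 ?divr_gt0// ?mulr_gt0 ?subr_gt0//.
Qed.

(* radius of the cap, as a chord length *)
Definition cap_chord (N : nat) : R := C2 * N%:R `^ (- (m^-1)).

Lemma cap_chord_gt0 N : (0 < N)%N -> 0 < cap_chord N.
Proof. by move=> N0; rewrite /cap_chord mulr_gt0 ?C2real_gt0// powR_gt0 ?ltr0n. Qed.

Lemma cap_chordX N (I : R) : (0 < N)%N -> @sine_mass R k.+2 = I%:E ->
  I = 2 * N%:R * cap_chord N ^+ k.+1 * (A / p + m^-1).
Proof.
move=> N0 IE; have [I' + I'E] := exists_sine_mass; rewrite IE => -[II']; rewrite II' {}I'E {I' II' IE}.
have m0 : 0 < m by [].
have s0 : 0 < s by apply: lt_trans s_gt.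
have p0 : 0 < p by rewrite subr_gt0.
have E : k.+2%:R - 1 = m :> R by rewrite -natr1 addrK.
have G1 := @Gamma_half_gt0 R k; have G2 := @Gamma_half_gt0 R k.+1; have G0 := @Gamma_half_gt0 R 0.
rewrite /cap_chord /C2real (_ : s - k.+2%:R + 1 = p); last by rewrite -[k.+2%:R]natr1; ring.
rewrite E.
set g1 := Gamma (m / 2); set g0 := Gamma (1 / 2); set g2 := Gamma (k.+2%:R / 2).
have N0R : 0 < N%:R :> R by rewrite ltr0n.
have root (x : R) : 0 <= x -> (x `^ m^-1) ^+ k.+1 = x.
  by move=> x0; rewrite -powR_mulrn ?powR_ge0// -powRrM mulVf ?powRr1// gt_eqF.
rewrite !exprMn div1r root; last by rewrite divr_ge0// ?mulr_ge0// ltW// ?subr_gt0.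
rewrite powRN exprVn root ?ltW//.
set sg := 1 + p / m; have sgE : sg = s / m by rewrite /sg; field; rewrite nat1r.
have sg0 : 0 < sg by rewrite sgE divr_gt0.
have -> : ((m / s) `^ (1 / s)) ^+ k.+1 = (sg `^ sg^-1)^-1.
  rewrite -powR_mulrn ?powR_ge0// -powRrM -powRN (_ : m / s = sg `^ (- 1)).
    rewrite -powRrM; congr (_ `^ _); rewrite sgE invf_div; by field; rewrite (gt_eqF s0).
  by rewrite powR_inv1 ?ltW// sgE invf_div.
rewrite /power_excess; set L := sg `^ _; have L0 : 0 < L by rewrite powR_gt0.
have -> : (1 + sg * (L - 1)) / p + m^-1 = s * L / (p * m).
  by rewrite sgE; field; rewrite nat1r (gt_eqF p0) pnatr_eq0.
have cancel (M P a b c n S : R) : M != 0 -> P != 0 -> c != 0 -> n != 0 -> S != 0 -> L != 0 ->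
    a * b / c = 2 * n * (M * P * a * b / (2 * S * c) / L / n) * (S * L / (P * M)).
  move: L {L0} => L M0 P0 c0 n0 S0 L0; field.
  by rewrite M0 P0 c0 n0 S0 L0.
by apply: cancel; rewrite ?pnatr_eq0// ?lt0r_neq0// -?lt0n.
Qed.

Lemma sine_mass_le (I : R) : (0 < k)%N -> @sine_mass R k.+2 = I%:E ->
  I * m <= 2 * Num.sqrt 2 ^+ k.+1.
Proof.
move=> k0 IE.
have m0 : 0 < m by [].
have H := @zonal_integral_le R k s 0 s_gt (lexx _) 0 1 ler01.
have c0 : chord (0 : R) = Num.sqrt 2 by rewrite /chord cosine0 subr0 mulr1.
have s1 : sine (0 : R) = 1 by rewrite /sine expr0n addr0 sqrtr1 invr1.
suff : (@sine_mass R k.+2 <= (2 * (Num.sqrt 2 ^+ k.+1 / m))%:E)%E.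
  by rewrite IE lee_fin mulrA ler_pdivlMr.
apply: le_trans (le_trans _ (H _ _)) _.
- rewrite /sine_mass le_eqVlt; apply/orP; left; apply/eqP; apply: eq_integral => t _.
  have q0 := one_sqr_gt0 t.
  have ge1 : 1 <= (sine t ^+ 2) `^ (- (s / 2)).
    rewrite sqr_sine -[(1 + t ^+ 2)^-1]powR_inv1 ?(ltW q0)// -powRrM mulN1r opprK.
    rewrite -[leLHS](powRr0 (1 + t ^+ 2)) ler_powR ?lerDl ?sqr_ge0//.
    by rewrite divr_ge0// ltW// (lt_trans m0).
  by rewrite s1 /truncated powR1 mul1r min_l ?mul1e//.
- by move=> F _; rewrite subrr mulr0 mul0r.
- by move=> x x0; rewrite mul1r; case: (k) k0 => // j _; exact: sineX_le_chord.
- by rewrite mulr0 mul0r add0r mul1r c0.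
Qed.

Lemma cap_small N : (2 <= N)%N -> let t := 1 - cap_chord N ^+ 2 / 2 in
  [/\ 0 <= t, t < 1,
      (0 < k)%N -> (1 - t) ^+ k.+1 * N%:R ^+ 2 < 1 &
      k = 0%N -> 1 - t <= 2 / N%:R ^+ 2].
Proof.
move=> N2 t; have m0 : 0 < m by [].
have s0 : 0 < s by apply: lt_trans s_gt.
have p0 : 0 < p by rewrite subr_gt0.
have N0 : (0 < N)%N by apply: leq_trans N2.
have N0R : 0 < N%:R :> R by rewrite ltr0n.
have N2R : 2 <= N%:R :> R by rewrite ler_nat.
have r0 := cap_chord_gt0 N0; set r := cap_chord N in t r0 *.
have sg1 : 1 <= 1 + p / m by rewrite lerDl divr_ge0// ltW.
have f0 : 0 <= power_excess (1 + p / m).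
  by apply: le_trans (power_excess_ge_ln sg1); rewrite ln_ge0.
have [I IE _] := exists_sine_mass; have := cap_chordX N0 IE; rewrite -/r => Ir.
have rX : 2 * N%:R * r ^+ k.+1 < I * m.
  rewrite Ir -[ltLHS]mulr1 -[ltRHS]mulrA ltr_pM2l ?mulr_gt0 ?exprn_gt0//.
  by rewrite mulrDl mulVf ?gt_eqF// ltrDr mulr_gt0// divr_gt0//; lra.
have tE : 1 - t = r ^+ 2 / 2 by rewrite /t subKr.
have k1 : (0 < k)%N -> (1 - t) ^+ k.+1 * N%:R ^+ 2 < 1.
  move=> k0; have := lt_le_trans rX (sine_mass_le k0 IE).
  rewrite -mulrA ltr_pM2l// => H.
  have S0 : 0 < Num.sqrt 2 :> R by rewrite sqrtr_gt0.
  rewrite tE (_ : r ^+ 2 / 2 = (r / Num.sqrt 2) ^+ 2); last by rewrite expr_div_n sqr_sqrtr.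
  rewrite exprAC -exprMn expr_lt1// ?mulr_ge0 ?exprn_ge0 ?divr_ge0 ?(ltW r0)//.
  by rewrite expr_div_n mulrAC ltr_pdivrMr ?exprn_gt0// mul1r mulrC.
have k00 : k = 0%N -> 1 - t <= 2 / N%:R ^+ 2.
  move=> k0; move: IE rX; rewrite k0 sine_mass2 => -[<-].
  rewrite mulr1 expr1 => rX; rewrite tE ler_pdivlMr ?exprn_gt0//.
  have rN : r * N%:R <= 2.
    by have := @pihalf_lt2 R; move: rX; rewrite -mulrA [_ * r]mulrC; lra.
  rewrite -mulrA mulrC -mulrA -exprMn.
  have : (N%:R * r) ^+ 2 <= 2 ^+ 2.
    by rewrite lerXn2r ?nnegrE ?(ltW (mulr_gt0 N0R r0))// mulrC.
  rewrite expr2; lra.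
split => //; last by rewrite -subr_gt0 tE divr_gt0// exprn_gt0.
rewrite -subr_ge0 leNgt; apply/negP => t0.
case: (posnP k) => [/k00|/k1].
  rewrite leNgt => /negP; apply; rewrite ltr_pdivrMr ?exprn_gt0//.
  apply: lt_le_trans (_ : 1 * N%:R ^+ 2 <= _).
    by rewrite mul1r expr2; have := ler_pM (ler0n R 2) (ler0n R 2) N2R N2R; lra.
  by rewrite ler_wpM2r ?sqr_ge0//; lra.
rewrite ltNge => /negP; apply.
apply: mulr_ege1; first by apply: exprn_ege1; lra.
by apply: exprn_ege1; lra.
Qed.

End ZonalBound.

Section ZonalBound.
Context {R : realType}.
Local Notation mu := (@lebesgue_measure R).
Variables (k : nat) (s : R).
Local Notation m := (k.+1%:R : R).
Local Notation p := (s - m).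
Hypothesis s_gt : m < s.
Local Notation A := (1 + power_excess (1 + p / m)).

(* near part *)
Lemma near_constant N (a y : R) : (2 <= N)%N -> 0 <= a -> 0 <= y ->
  cosine a = 1 - cap_chord k s N ^+ 2 / 2 -> y ^+ 2 * (1 + cosine a) = 2 ->
  exists2 H : R, (N%:R - 1) * H <= N%:R * (y ^+ k.+1 * A) &
  forall F : R -> R,
    (forall x : R, 0 <= x -> is_derive x 1 F ((1 + x ^+ 2) `^ ((p - 1) / 2))) ->
    p * (F a - F 0) <= H * (1 + a ^+ 2) `^ (p / 2).
Proof.
move=> N2 a0 y0 ca yE; have m0 : 0 < m by [].
have m1 : 1 <= m by rewrite ler1n.
have p0 : 0 < p by rewrite subr_gt0.
have N2R : 2 <= N%:R :> R by rewrite ler_nat.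
have [t0 t1 tk t00] := cap_small s_gt N2; rewrite -ca in t0 t1 tk t00.
have z0 : 0 < p / m by rewrite divr_gt0.
have f0 : 0 <= power_excess (1 + p / m).
  by apply: le_trans (power_excess_ge_ln _); rewrite ?ln_ge0// lerDl ltW.
have y1 := chord_ratio_ge1 t0 (ltW t1) y0 yE.
have weaken (h : R) : 0 <= h -> h <= y ^+ k.+1 * A -> (N%:R - 1) * h <= N%:R * (y ^+ k.+1 * A).
  by move=> h0 hle; apply: ler_pM => //; lra.
have [p1|p1] := leP p 1.
  exists (cosine a); last by move=> F dF; exact: (tail_le_small dF p1 a0).
  apply: weaken => //; apply: le_trans (ltW t1) _.
  by apply: mulr_ege1; [exact: exprn_ege1|rewrite lerDl].
have [z8|z8] := leP (p / m) (15 / 2).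
  exists (1 + Num.sqrt (p * (1 - cosine a))); last first.
    by move=> F dF; exact: (tail_le_sqrt p0 dF (ltW p1) a0).
  apply: weaken; first by rewrite addr_ge0 ?sqrtr_ge0.
  have := sqrt_tail_le t0 (ltW t1) y0 yE k.+1 (ltW z0) f0 (power_excess_small (ltW z0) z8).
  by rewrite divfK ?pnatr_eq0.
have A3 := power_excess_large (ltW z8).
have tp : 0 < cosine a.
  rewrite lt_neqAle t0 andbT eq_sym; apply/eqP => E.
  case: (posnP k) => [/t00|/tk]; rewrite E subr0.
    apply/negP; rewrite -ltNge ltr_pdivrMr; last by rewrite exprn_gt0//; lra.
    by rewrite mul1r expr2; have := ler_pM (ler0n R 2) (ler0n R 2) N2R N2R; lra.
  by rewrite expr1n mul1r; apply/negP; rewrite -leNgt exprn_ege1//; lra.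
exists (2 / cosine a); last by move=> F dF; exact: (tail_le_inv p0 dF (ltW p1) a0 tp).
have [k0|k0] := posnP k.
  have := inv_tail_le1 t0 (ltW t1) y0 yE A3 N2 (t00 k0).
  by rewrite k0 expr1.
exact: (inv_tail_le (m := k.+1) t0 (ltW t1) y0 yE A3 k0 N2 tp t1 (tk k0)).
Qed.

(* far part *)
Lemma far_constant N (a y : R) : (2 <= N)%N -> 0 <= a -> 0 <= y ->
  cosine a = 1 - cap_chord k s N ^+ 2 / 2 -> y ^+ 2 * (1 + cosine a) = 2 ->
  exists C : R, [/\ 0 <= C, (N%:R - 1) * C < N%:R &
  forall x, a <= x -> sine x ^+ k.+2 <= C * (chord x ^+ k * (sine x ^+ 3 / chord x))].
Proof.
move=> N2 a0 y0 ca yE.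
have N2R : 2 <= N%:R :> R by rewrite ler_nat.
have [t0 t1 _ t00] := cap_small s_gt N2; rewrite -ca in t0 t1 t00.
have [k0|k0] := posnP k; last first.
  exists 1; split => //; first lra.
  by move=> x _; rewrite mul1r; case: (k) k0 => // j _; exact: sineX_le_chord.
exists y; split => //; first exact: (chord_ratio_lt t0 (ltW t1) y0 yE N2 (t00 k0)).
move=> x ax; rewrite k0 expr0 mul1r.
rewrite mulrA ler_pdivlMr ?chord_gt0// [sine x ^+ 3]exprS [leLHS]mulrC [leRHS]mulrA.
rewrite ler_wpM2r ?sqr_ge0//.
rewrite -(@ler_pXn2r _ 2) ?nnegrE ?(ltW (chord_gt0 _)) ?mulr_ge0 ?(ltW (sine_gt0 _))//.
rewrite sqr_chord exprMn -[sine x ^+ 2](subKr 1) -sqr_cosine.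
have cax := cosine_le ax; have c1 := cosine_lt1 x.
have : y ^+ 2 * (1 + cosine a) <= y ^+ 2 * (1 + cosine x) by rewrite ler_wpM2l ?sqr_ge0//; lra.
rewrite yE => H.
rewrite (_ : 1 - cosine x ^+ 2 = (1 + cosine x) * (1 - cosine x)); last by ring.
by rewrite mulrA ler_wpM2r//; lra.
Qed.

Lemma zonal_integral_lt N : (2 <= N)%N -> let r := cap_chord k s N in
  exists2 rho : R, 0 < rho /\ rho ^+ 2 = 1 - (1 - r ^+ 2 / 2) ^+ 2 &
  (N.-1%:R%:E * \int[mu]_t ((truncated s rho (sine t ^+ 2))%:E * (sine t ^+ k.+2)%:E)
    < sine_mass k.+2)%E.
Proof.
move=> N2 r; have m0 : 0 < m by [].
have p0 : 0 < p by rewrite subr_gt0.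
have N0 : (0 < N)%N by apply: leq_trans N2.
have N2R : 2 <= N%:R :> R by rewrite ler_nat.
have [t0 t1 _ _] := cap_small s_gt N2; rewrite -/r in t0 t1.
have [a a0 ca] := exists_cosine (introT andP (conj t0 t1)).
have r0 : 0 < r by exact: cap_chord_gt0.
have s0 := sine_gt0 a.
exists (sine a); first by split=> //; rewrite -ca sqr_cosine subKr.
have chr : chord a = r.
  by rewrite /chord ca subKr mulrC divfK ?pnatr_eq0// sqrtr_sqr ger0_norm// ltW.
have y0 : 0 <= r / sine a by rewrite divr_ge0// ltW.
have yE : (r / sine a) ^+ 2 * (1 + cosine a) = 2.
  rewrite -chr expr_div_n sqr_chord -[sine a ^+ 2](subKr 1) -sqr_cosine.
  have c1 := cosine_lt1 a; have c0 := cosine_ge0 a0.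
  have -> : 1 - cosine a ^+ 2 = (1 - cosine a) * (1 + cosine a) by ring.
  by field; rewrite !gt_eqF//; lra.
have [H HN HP] := near_constant N2 a0 y0 ca yE.
have [C [C0 CN CP]] := far_constant N2 a0 y0 ca yE.
have [I IE _] := @exists_sine_mass R k.
rewrite IE; apply: (@le_lt_trans _ _ ((N%:R - 1) * (2 * (sine a ^+ k.+1 * H / p + C * (chord a ^+ k.+1 / m))))%:E).
  rewrite EFinM -subn1 natrB//; rewrite lee_wpmul2l//; first by rewrite lee_fin; lra.
  exact: (zonal_integral_le s_gt a0 C0 HP CP).
rewrite lte_fin (cap_chordX s_gt N0 IE) -/r chr.
set n : R := N%:R - 1 in HN CN *; set B := r ^+ k.+1; set S := sine a ^+ k.+1.
have S0 : 0 < S by rewrite exprn_gt0.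
have B0 : 0 < B by rewrite exprn_gt0.
have h1 : n * (S * H / p) <= N%:R * B * (A / p).
  rewrite (_ : n * (S * H / p) = S * (n * H) / p); last by ring.
  rewrite [leRHS]mulrA ler_pM2r ?invr_gt0//.
  apply: le_trans (ler_wpM2l (ltW S0) HN) _.
  rewrite expr_div_n -/B -/S le_eqVlt; apply/orP; left; apply/eqP; field.
  by rewrite gt_eqF.
have h2 : n * (C * (B / m)) < N%:R * B * m^-1.
  rewrite [ltLHS]mulrA -[ltRHS]mulrA ltr_pM2r//.
  by rewrite divr_gt0.
rewrite mulrCA mulrDr -[2 * _ * _]mulrA -[ltRHS]mulrA ltr_pM2l// [ltRHS]mulrDr.
exact: ler_ltD h1 h2.
Qed.

End ZonalBound.

Section Scalars.
Context {R : realType} {H : scalars}.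
Local Notation K := (scalarH R H).
Implicit Types (z w : K).

Lemma absH_ge0 z : 0 <= absH z.
Proof. by case: H z => z; rewrite /absH ?normc_def /= ?sqrtr_ge0. Qed.

Lemma absHM z w : absH (z * w) = absH z * absH w.
Proof.
case: H z w => z w; rewrite /absH ?normrM//.
by rewrite !normc_def -rmorphM.
Qed.

Lemma absH_conj z : absH (conjH z) = absH z.
Proof. by case: H z => z //; rewrite /absH /conjH normcJ. Qed.

Lemma absH0 : absH (0 : K) = 0.
Proof. by case: H; rewrite /absH normr0. Qed.

Lemma ler_absHD z w : absH (z + w) <= absH z + absH w.
Proof.
case: H z w => z w; rewrite /absH; first exact: ler_normD.
by rewrite !normc_def /=; have := le_normcD z w; case: z => a b; case: w => c e.
Qed.

Lemma conjHD z w : conjH (z + w) = conjH z + conjH w.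
Proof. by case: H z w => z w //=; rewrite rmorphD. Qed.

Lemma conjHM z w : conjH (z * w) = conjH z * conjH w.
Proof. by case: H z w => z w //=; rewrite rmorphM. Qed.

Lemma conjH0 : conjH (0 : K) = 0.
Proof. by case: H => //; exact: conjc0. Qed.

Lemma conjHK z : conjH (conjH z) = z.
Proof. by case: H z => z //=; rewrite conjcK. Qed.

Variable d : nat.
Implicit Types (x y : 'cV[K]_d).

Lemma inner_conj x y : inner y x = conjH (inner x y).
Proof.
rewrite /inner (big_morph _ conjHD conjH0); apply: eq_bigr => k _.
by rewrite conjHM conjHK mulrC.
Qed.

Lemma absH_innerC x y : absH (inner x y) = absH (inner y x).
Proof. by rewrite [in RHS]inner_conj absH_conj. Qed.

Lemma sqr_vnorm x : vnorm x ^+ 2 = \sum_(k < d) absH (x k 0) ^+ 2.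
Proof. by rewrite sqr_sqrtr// sumr_ge0// => k _; rewrite sqr_ge0. Qed.

Lemma absH_sum (I : Type) (r : seq I) (F : I -> K) :
  absH (\sum_(i <- r) F i) <= \sum_(i <- r) absH (F i).
Proof.
elim: r => [|i r IH]; first by rewrite !big_nil absH0.
by rewrite !big_cons (le_trans (ler_absHD _ _))// lerD2l.
Qed.

Lemma absH_inner_le1 x y : vnorm x = 1 -> vnorm y = 1 -> absH (inner x y) <= 1.
Proof.
move=> x1 y1; apply: le_trans (absH_sum _ _) _.
apply: le_trans (_ : \sum_(k < d) (absH (x k 0) ^+ 2 + absH (y k 0) ^+ 2) / 2 <= _).
  apply: ler_sum => k _; rewrite absHM absH_conj ler_pdivlMr//.
  have := sqr_ge0 (absH (x k 0) - absH (y k 0)); rewrite !expr2; lra.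
by rewrite -mulr_suml big_split/= -!sqr_vnorm x1 y1 expr1n; lra.
Qed.

End Scalars.

Section Energy.
Context {R : realType} {H : scalars}.
Local Notation K := (scalarH R H).
Variables (d N : nat) (s : R).
Hypothesis s_gt0 : 0 < s.
Local Open Scope ereal_scope.
Implicit Types (x y : 'cV[K]_d) (X Y : configuration R H d N) (i j l : 'I_N).

Lemma pair_energyC x y : pair_energy s x y = pair_energy s y x.
Proof. by rewrite /pair_energy absH_innerC. Qed.

Lemma pair_energy_ge0 x y : 0 <= pair_energy s x y.
Proof. by rewrite /pair_energy; case: ifP => // _; rewrite lee_fin divr_ge0 ?powR_ge0. Qed.

Definition potential X i x : \bar R := \sum_(l < N | l != i) pair_energy s x (X l).

Definition rest_energy X i : \bar R :=
  \sum_(a < N | a != i) \sum_(b < N | (a != b) && (b != i)) pair_energy s (X a) (X b).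

Lemma potential_ge0 X i x : 0 <= potential X i x.
Proof. by apply: sume_ge0 => l _; exact: pair_energy_ge0. Qed.

Lemma rest_energy_ge0 X i : 0 <= rest_energy X i.
Proof. by do 2! apply: sume_ge0 => ? _; exact: pair_energy_ge0. Qed.

Lemma energy_split X i :
  energy s X = potential X i (X i) + (potential X i (X i) + rest_energy X i).
Proof.
rewrite /energy -(pair_big_dep xpredT (fun a b => a != b)
  (fun a b => pair_energy s (X a) (X b)))/= (bigD1 i)//=; congr (_ + _).
  by apply: eq_bigl => l; rewrite eq_sym.
rewrite /potential /rest_energy -big_split/=; apply: eq_bigr => a ai.
by rewrite (bigD1 i)//= pair_energyC.
Qed.

Definition replace X i x : configuration R H d N := fun l => if l == i then x else X l.

Lemma unit_replace X i x : unit_configs X -> vnorm x = 1%R -> unit_configs (replace X i x).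
Proof. by move=> X1 x1 l; rewrite /replace; case: ifP. Qed.

Lemma energy_replace X i x :
  energy s (replace X i x) = potential X i x + (potential X i x + rest_energy X i).
Proof.
have E : potential (replace X i x) i (replace X i x i) = potential X i x.
  by apply: eq_bigr => l /negbTE li; rewrite /replace eqxx li.
rewrite (energy_split _ i) E; congr (_ + (_ + _)).
apply: eq_bigr => a /negbTE ai; apply: eq_bigr => b /andP[_ /negbTE bi].
by rewrite /replace ai bi.
Qed.

Variable rho : R.
Hypothesis rho_gt0 : (0 < rho)%R.
Local Notation kap := (fun x y => kernel (truncated s rho) (absH (inner x y)) 1).

Lemma pair_energy_kernel x y : vnorm x = 1%R -> vnorm y = 1%R -> (kap x y < 1)%R ->
  pair_energy s x y = (rho `^ (- s) * kap x y)%:E.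
Proof.
move=> x1 y1; rewrite /kernel; case: ifPn => [a1|]; last by rewrite ltxx.
rewrite divr1 /truncated; set t := (_ * _)%R.
have [t1|t1] := leP 1%R t; first by rewrite ltxx.
move=> _; rewrite /t {t t1}.
rewrite /pair_energy ifF; last first.
  by apply/negbTE/eqP => E; move: a1; rewrite E expr1n ltxx.
rewrite mulrA -powRD ?(gt_eqF rho_gt0) ?implybT// addNr powRr0 !mul1r powRN//.
Qed.

Hypothesis gap : forall X i, unit_configs X ->
  exists2 x, vnorm x = 1%R & (\sum_(l < N | l != i) kap x (X l) < 1)%R.

Lemma exists_small_potential X i : unit_configs X ->
  exists2 x, vnorm x = 1%R & potential X i x < (rho `^ (- s))%:E.
Proof.
move=> X1; have [x x1 xs] := gap i X1; exists x => //.
have k0 l : (0 <= kap x (X l))%R by apply: kernel_ge0 => q; exact: truncated_ge0.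
have kl l : l != i -> (kap x (X l) < 1)%R.
  move=> li; apply: le_lt_trans xs; rewrite (bigD1 l)//= lerDl.
  by apply: sumr_ge0.
rewrite /potential (eq_bigr (fun l => (rho `^ (- s) * kap x (X l))%:E)).
  by rewrite sumEFin lte_fin -mulr_sumr -[ltRHS]mulr1 ltr_pM2l// powR_gt0.
by move=> l li; rewrite pair_energy_kernel//; exact: kl.
Qed.

Lemma minimizer_energy_lty X : minimizer s X -> energy s X < +oo.
Proof.
move=> [X1 Xmin].
suff [Y Y1 Yfin] : exists2 Y : configuration R H d N, unit_configs Y & forall a b : 'I_N, a != b ->
    pair_energy s (Y a) (Y b) < +oo.
  apply: le_lt_trans (Xmin Y Y1) _; apply: lte_sum_pinfty => -[a b] /= ab.
  exact: Yfin.
have step n : exists2 Y : configuration R H d N, unit_configs Y & forall a b : 'I_N, (a < n)%N -> (b < n)%N ->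
    a != b -> pair_energy s (Y a) (Y b) < +oo.
  elim: n => [|n [Y Y1 Yfin]]; first by exists X.
  have [nN|Nn] := ltnP n N; last first.
    by exists Y => // a b _ _; apply: Yfin; apply: leq_trans Nn.
  pose i := Ordinal nN; have [x x1 xp] := exists_small_potential i Y1.
  have xl l : l != i -> pair_energy s x (Y l) < +oo.
    move=> li; apply: le_lt_trans (lt_trans xp (ltry _)).
    rewrite /potential (bigD1 l)//= leeDl// sume_ge0// => ? _.
    exact: pair_energy_ge0.
  have lt_n (l : 'I_N) : (l < n.+1)%N -> l != i -> (l < n)%N.
    by rewrite ltnS leq_eqVlt -val_eqE /= => /predU1P[->|//]; rewrite eqxx.
  exists (replace Y i x); first exact: unit_replace.
  move=> a b an bn ab; rewrite /replace.
  case: eqVneq => [ai|ai]; case: eqVneq => [bi|bi].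
  - by move: ab; rewrite ai bi eqxx.
  - exact: xl.
  - by rewrite pair_energyC; exact: xl.
  - by apply: Yfin => //; exact: lt_n.
by have [Y Y1 Yfin] := step N; exists Y => // a b; apply: Yfin.
Qed.

Lemma minimizer_separated X i j : minimizer s X -> i != j ->
  (absH (inner (X i) (X j)) ^+ 2 <= 1 - rho ^+ 2)%R.
Proof.
move=> minX ij; have [X1 Xmin] := minX.
have [x x1 xU] := exists_small_potential i X1.
have := Xmin _ (unit_replace i X1 x1); rewrite energy_replace.
have := minimizer_energy_lty minX; rewrite (energy_split X i).
have := rest_energy_ge0 X i; have := potential_ge0 X i (X i); have := potential_ge0 X i x.
move: xU; set U := potential X i (X i); have : pair_energy s (X i) (X j) <= U.
  rewrite /U /potential (bigD1 j) 1?eq_sym//= leeDl// sume_ge0// => ? _.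
  exact: pair_energy_ge0.
move: U (potential _ _ _) (rest_energy _ _).
move=> [U| |] [V| |] [Q| |]//= + VU.
rewrite /pair_energy; case: eqP => // a1.
rewrite !lee_fin => eU _ _ _ _ UV.
set a := absH _ in a1 eU *.
have a_le1 : (a <= 1)%R by exact: absH_inner_le1.
have a0 : (0 <= a)%R by exact: absH_ge0.
have a_lt1 : (a < 1)%R by rewrite lt_neqAle a_le1 andbT; apply/eqP.
have q0 : (0 < 1 - a ^+ 2)%R by rewrite subr_gt0 expr_lt1.
move: VU; rewrite lte_fin => VU.
have : ((1 - a ^+ 2) `^ (- (s / 2)) < (rho ^+ 2) `^ (- (s / 2)))%R.
  rewrite -[(rho ^+ 2)%R]powR_mulrn ?ltW// -powRrM (_ : (2 * - (s / 2) = - s)%R); last by field.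
  have UV' : (U <= V)%R by lra.
  by rewrite powRN -[ltLHS]mul1r; apply: le_lt_trans VU; apply: le_trans UV'.
rewrite !powRN ltf_pV2 ?posrE ?powR_gt0 ?exprn_gt0// => lt.
have s20 : (0 <= s / 2)%R by rewrite divr_ge0// ltW.
rewrite leNgt; apply/negP => H1.
move: lt; rewrite ltNge => /negP; apply.
by rewrite ge0_ler_powR ?nnegrE ?(ltW q0) ?sqr_ge0//; lra.
Qed.

End Energy.

Section RealSeparation.
Context {R : realType}.

Lemma coherence_le (H : scalars) d N (X : configuration R H d N) (b : R) : 0 <= b ->
  (forall i j, i != j -> absH (inner (X i) (X j)) <= b) -> coherence X <= b.
Proof. by move=> b0 Xb; apply: bigmax_le => // -[i j] /= ij; exact: Xb. Qed.

Lemma real_gap k (s : R) N rho (X : configuration R RealScalars k.+2 N) (i : 'I_N) :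
  (2 <= N)%N -> unit_configs X ->
  (N.-1%:R%:E * \int[lebesgue_measure]_t ((truncated s rho (sine t ^+ 2))%:E * (sine t ^+ k.+2)%:E)
    < sine_mass k.+2)%E ->
  exists2 x : 'cV[scalarH R RealScalars]_k.+2, vnorm x = 1 &
    \sum_(l < N | l != i) kernel (truncated s rho) (absH (inner x (X l))) 1 < 1.
Proof.
move=> N2 X1 small.
pose y (l : 'I_N) (j : nat) : R := X l (inord j) 0.
pose r := [seq l <- index_enum 'I_N | l != i].
have rN : size r = N.-1.
  have <- : #|predC1 i| = N.-1 by rewrite cardC1 card_ord.
  by rewrite cardE /enum_mem; congr size; apply: eq_filter => l; rewrite !inE.
have y1 l : sqn k.+2 (y l) = 1.
  have := X1 l => /(congr1 (fun a => a ^+ 2)); rewrite sqr_vnorm expr1n => <-.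
  apply: eq_bigr => j _; rewrite /y /absH inord_val.
  by rewrite real_normK// num_real.
have [|||||x x1 xs] := @exists_unit_kernel R (truncated s rho) _ _ 'I_N r k y _ y1.
- exact: measurable_truncated.
- by move=> q; exact: truncated_ge0.
- by rewrite rN; case: N N2 {X i X1 small y r rN y1} => [|[]].
- by rewrite ge0_fin_numE ?sine_mass_ltpinfty//; apply: integral_ge0 => t _; rewrite lee_fin exprn_ge0// ltW// sine_gt0.
- by rewrite rN.
pose v : 'cV[scalarH R RealScalars]_k.+2 := \col_(j < k.+2) (x j : R).
exists v.
  rewrite /vnorm -[RHS]sqrtr1 -x1; congr Num.sqrt; apply: eq_bigr => j _.
  by rewrite mxE /absH real_normK// num_real.
move: xs; rewrite big_filter; congr (_ < 1); apply: eq_bigr => l _.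
rewrite /kernel /absH real_normK ?num_real//.
have -> : inner v (X l) = dot k.+2 x (y l).
  by apply: eq_bigr => j _; rewrite mxE /y inord_val.
by [].
Qed.

Lemma real_separation k (s : R) N (X : configuration R RealScalars k.+2 N) :
  (2 <= N)%N -> k.+1%:R < s -> minimizer s X ->
  coherence X <= 1 - C2real k.+2 s ^+ 2 / 2 * N%:R `^ (- (2 / k.+1%:R)).
Proof.
move=> N2 s_gt minX.
have m0 : 0 < k.+1%:R :> R by [].
have s0 : 0 < s by apply: lt_trans s_gt.
have [rho [rho0 rhoE] small] := zonal_integral_lt s_gt N2.
have [t0 _ _ _] := cap_small s_gt N2.
have rE : cap_chord k s N ^+ 2 = C2real k.+2 s ^+ 2 * N%:R `^ (- (2 / k.+1%:R)).
  rewrite exprMn; congr (_ * _); rewrite -powR_mulrn ?powR_ge0// -powRrM.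
  by congr (_ `^ _); field; rewrite nat1r.
rewrite mulrAC -rE; apply: coherence_le => // i j ij.
have gap (Y : configuration R RealScalars k.+2 N) i0 : unit_configs Y -> _ := fun Y1 => real_gap i0 N2 Y1 small.
have := minimizer_separated s0 rho0 gap minX ij; rewrite rhoE subKr.
by rewrite ler_pXn2r// nnegrE// absH_ge0.
Qed.

End RealSeparation.

Section PowerSums.
Context {R : realType}.

Lemma powR_sum_step (th : R) (u : nat) : 1 < th ->
  u.+2%:R `^ (- th) <= (u.+1%:R `^ (1 - th) - u.+2%:R `^ (1 - th)) / (th - 1).
Proof.
move=> th1.
have le12 : u.+1%:R <= u.+2%:R :> R by rewrite ler_nat.
have pos (x : R) : u.+1%:R <= x -> 0 < x by apply: lt_le_trans.
pose c : R := u.+2%:R `^ (- th).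
have := @is_derive_le R (fun x => c * x) (fun x => - (th - 1)^-1 * x `^ (1 - th)) (fun=> c)
  (fun x => x `^ (- th)) _ _ le12 _ _ _.
have d1 : u.+2%:R - u.+1%:R = 1 :> R by rewrite -[u.+2%:R]natr1 addrAC subrr add0r.
rewrite -mulrBr d1 mulr1 => H.
apply: le_trans (H _ _ _) _.
- move=> x _; have := @is_deriveZ _ _ _ id c x 1 _ (is_derive_id (x : R) (1 : R)).
  by rewrite /GRing.scale/= mulr1.
- move=> x /andP[/pos x0 _].
  have d := @is_deriveZ _ _ _ (fun x => x `^ (1 - th)) (- (th - 1)^-1) x 1 _ (is_derive1_powR (1 - th) x0).
  apply: (is_derive_eq d); rewrite /GRing.scale/= (_ : 1 - th - 1 = - th); last by ring.
  by field; rewrite gt_eqF; lra.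
- move=> x /andP[/pos x0 xu]; rewrite /c !powRN lef_pV2 ?posrE ?powR_gt0//.
  by rewrite ge0_ler_powR ?nnegrE ?(ltW x0)//; lra.
rewrite le_eqVlt; apply/orP; left; apply/eqP; field; rewrite gt_eqF; lra.
Qed.

(* the coordinatewise kernel *)
Definition decay (th : R) (u : nat) : R := (maxn 1 u)%:R `^ (- th).

Definition decay_sum (th : R) : R := 2 + (th - 1)^-1.

Lemma sum_decay_le (th : R) n : 1 < th -> \sum_(u < n) decay th u <= decay_sum th.
Proof.
move=> th1; have th0 : 0 < th - 1 by lra.
case: n => [|[|n]]; first by rewrite big_ord0 addr_ge0// invr_ge0 ltW.
  have : 0 < (th - 1)^-1 by rewrite invr_gt0.
  by rewrite big_ord1 /decay /= powR1 /decay_sum; lra.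
have tel k : \sum_(u < k) decay th u.+2 <= (1 - k.+1%:R `^ (1 - th)) / (th - 1).
  elim: k => [|k IH]; first by rewrite big_ord0 powR1 subrr mul0r.
  rewrite big_ord_recr/=; apply: le_trans (lerD IH (powR_sum_step k th1)) _.
  by rewrite -mulrDl addrA subrK.
rewrite !big_ord_recl/= /decay_sum /decay !powR1 addrA lerD2l.
apply: le_trans (tel n) _.
by rewrite -[leRHS]mul1r ler_wpM2r ?invr_ge0 ?(ltW th0)// gerBl powR_ge0.
Qed.

Lemma sum_decay_dist_le (th : R) n (b : 'I_n) : 1 < th ->
  \sum_(a < n) decay th `|a - b|%N <= 2 * decay_sum th.
Proof.
move=> th1.
rewrite -(big_mkord xpredT (fun a => decay th `|a - b|%N)).
rewrite (@big_cat_nat _ _ _ b)//=; last exact: ltnW.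
rewrite mulr_natl mulr2n lerD//.
  rewrite big_nat_rev/= add0n big_mkord; apply: le_trans (sum_decay_le b th1).
  apply: ler_sum => u _; rewrite /decay !powRN lef_pV2 ?posrE ?powR_gt0//.
  rewrite ge0_ler_powR ?nnegrE// ?(le_trans ler01 (ltW th1))// ler_nat.
  by have := ltn_ord u; lia.
rewrite -{1}[val b]add0n big_addn big_mkord; apply: le_trans (sum_decay_le (n - b) th1).
by rewrite le_eqVlt; apply/orP; left; apply/eqP; apply: eq_bigr => u _; rewrite PoszD addrK.
Qed.

End PowerSums.

Section ProjectiveEmbedding.
Context {R : realType}.
Local Notation K := (scalarH R ComplexScalars).
Variable d : nat.
Implicit Types (x y w : 'cV[K]_d).

(* entries of x x^* *)
Definition projector x (i j : 'I_d) : R[i] := x i 0 * conjc (x j 0 : R[i]).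

Definition abs2 (z : R[i]) : R := @absH R ComplexScalars z ^+ 2.

Lemma abs2E z : (abs2 z)%:C%C = z * conjc z.
Proof. by rewrite /abs2 /absH -sqr_normc normc_def -rmorphXn. Qed.

Lemma abs2_ge0 z : 0 <= abs2 z. Proof. exact: sqr_ge0. Qed.

Lemma abs2_re_im z : abs2 z = complex.Re z ^+ 2 + complex.Im z ^+ 2.
Proof. by rewrite /abs2 /absH normc_def/= sqr_sqrtr// addr_ge0// sqr_ge0. Qed.

Lemma abs2D z z' : abs2 (z + z') <= 2 * abs2 z + 2 * abs2 z'.
Proof.
rewrite !abs2_re_im !raddfD /=.
have := sqr_ge0 (complex.Re z - complex.Re z').
have := sqr_ge0 (complex.Im z - complex.Im z'); rewrite !expr2; lra.
Qed.

Lemma abs2M z z' : abs2 (z * z') = abs2 z * abs2 z'.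
Proof. by rewrite /abs2 (@absHM R ComplexScalars) exprMn. Qed.

Lemma abs2N z : abs2 (- z) = abs2 z.
Proof. by rewrite !abs2_re_im !raddfN /= !sqrrN. Qed.

Definition sqdist x y : R := \sum_(i < d) \sum_(j < d) abs2 (projector x i j - projector y i j).

Lemma sqdistE x y : vnorm x = 1 -> vnorm y = 1 ->
  sqdist x y = 2 * (1 - absH (inner x y) ^+ 2).
Proof.
move=> x1 y1.
have unit (v : 'cV[K]_d) : vnorm v = 1 -> \sum_(i < d) (v i 0 : R[i]) * conjc (v i 0 : R[i]) = 1.
  move=> v1; have := sqr_vnorm v; rewrite v1 expr1n => v2.
  under eq_bigr do rewrite -abs2E.
  by rewrite -rmorph_sum -v2 rmorph1.
have innerE : (absH (inner x y) ^+ 2)%:C%C =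
    (\sum_(i < d) (x i 0 : R[i]) * conjc (y i 0 : R[i])) * (\sum_(i < d) (y i 0 : R[i]) * conjc (x i 0 : R[i])).
  rewrite -/(abs2 (inner x y)) abs2E; congr (_ * _).
  by rewrite -[conjc _]/(conjH (inner x y)) -inner_conj.
move: (absH _ ^+ 2) innerE => q innerE.
have inj : injective (@real_complex R) by move=> a b [].
apply: inj; rewrite /sqdist rmorph_sum.
transitivity (\sum_(i < d) \sum_(j < d)
  (((x i 0 : R[i]) * conjc (x i 0 : R[i])) * ((x j 0 : R[i]) * conjc (x j 0 : R[i])) +
   ((y i 0 : R[i]) * conjc (y i 0 : R[i])) * ((y j 0 : R[i]) * conjc (y j 0 : R[i])) -
   (((x i 0 : R[i]) * conjc (y i 0 : R[i])) * ((y j 0 : R[i]) * conjc (x j 0 : R[i])) +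
    ((y i 0 : R[i]) * conjc (x i 0 : R[i])) * ((x j 0 : R[i]) * conjc (y j 0 : R[i]))))).
  apply: eq_bigr => i _; rewrite rmorph_sum; apply: eq_bigr => j _.
  rewrite /= abs2E /projector rmorphB !rmorphM /= !conjcK; ring.
under eq_bigr do rewrite sumrB !big_split/= -!mulr_sumr.
rewrite sumrB !big_split/= -!mulr_suml !unit// rmorphM rmorphB /= innerE.
rewrite rmorph1 rmorph_nat; ring.
Qed.

Lemma sqdistC x y : sqdist x y = sqdist y x.
Proof.
by apply: eq_bigr => i _; apply: eq_bigr => j _; rewrite -abs2N opprB.
Qed.

Lemma sqdist_triangle y x w : sqdist x w <= 2 * sqdist x y + 2 * sqdist y w.
Proof.
rewrite /sqdist !mulr_sumr -big_split/=; apply: ler_sum => i _.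
rewrite !mulr_sumr -big_split/=; apply: ler_sum => j _.
have := abs2D (projector x i j - projector y i j) (projector y i j - projector w i j).
by rewrite addrA subrK.
Qed.

Lemma abs2_projector_le x y (i j : 'I_d) : abs2 (projector x i j - projector y i j) <= sqdist x y.
Proof.
rewrite /sqdist (bigD1 i)//= (bigD1 j)//= -addrA lerDl addr_ge0// sumr_ge0// => k _.
  exact: abs2_ge0.
by apply: sumr_ge0 => l _; exact: abs2_ge0.
Qed.

End ProjectiveEmbedding.

Section ProjectiveGrid.
Context {R : realType}.
Local Notation K := (scalarH R ComplexScalars).
Variables e n : nat.
Hypothesis n0 : (0 < n)%N.
Local Notation index := ('I_e * bool)%type.
Local Notation grid := {ffun index -> 'I_n}.
Implicit Types (g h : grid) (k : 'I_e) (j : index).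

Definition affine_point g k : R[i] :=
  Complex ((g (k, false))%:R / n%:R) ((g (k, true))%:R / n%:R).

Definition weight g : R := (1 + \sum_(k < e) abs2 (affine_point g k))^-1.

Definition grid_point g : 'cV[K]_e.+1 :=
  \col_i ((Num.sqrt (weight g))%:C%C *
          (if unlift ord0 i is Some k then affine_point g k else 1)).

Lemma abs2_affine_point_le2 g k : abs2 (affine_point g k) <= 2.
Proof.
have n0R : 0 < n%:R :> R by rewrite ltr0n.
have le1 j : ((g j)%:R / n%:R) ^+ 2 <= 1 :> R.
  by rewrite exprn_ile1 ?divr_ge0// ler_pdivrMr// mul1r ler_nat ltnW.
by rewrite abs2_re_im /=; have := le1 (k, false); have := le1 (k, true); lra.
Qed.

Let norm_ge1 g : 1 <= 1 + \sum_(k < e) abs2 (affine_point g k).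
Proof. by rewrite lerDl sumr_ge0// => k _; exact: abs2_ge0. Qed.

Lemma weight_gt0 g : 0 < weight g.
Proof. by rewrite invr_gt0 (lt_le_trans ltr01). Qed.

Lemma weight_ge g : 1 <= (1 + 2 * e%:R) * weight g.
Proof.
rewrite ler_pdivlMr ?(lt_le_trans ltr01)// mul1r lerD2l.
apply: le_trans (_ : \sum_(k < e) 2 <= _); first by apply: ler_sum => k _; exact: abs2_affine_point_le2.
by rewrite sumr_const card_ord mulr_natr.
Qed.

Let abs2_real (a : R) : abs2 a%:C%C = a ^+ 2.
Proof. by rewrite abs2_re_im /= expr0n addr0. Qed.

Lemma vnorm_grid_point g : vnorm (grid_point g) = 1.
Proof.
rewrite /vnorm -[RHS]sqrtr1; congr Num.sqrt.
under eq_bigr => i _ do rewrite mxE -/(abs2 _) abs2M abs2_real sqr_sqrtr ?(ltW (weight_gt0 g))//.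
rewrite -mulr_sumr big_ord_recl unlift_none.
under eq_bigr do rewrite liftK.
by rewrite (abs2_real 1) expr1n mulVf// gt_eqF// (lt_le_trans ltr01).
Qed.

Lemma projector_grid0 g : projector (grid_point g) ord0 ord0 = (weight g)%:C%C.
Proof.
rewrite /projector !mxE unlift_none mulr1 conjc_real -rmorphM -expr2 sqr_sqrtr//.
exact: ltW (weight_gt0 g).
Qed.

Lemma projector_grid g k :
  projector (grid_point g) (lift ord0 k) ord0 = (weight g)%:C%C * affine_point g k.
Proof.
rewrite /projector !mxE unlift_none liftK mulr1 conjc_real mulrAC -rmorphM -expr2 sqr_sqrtr//.
exact: ltW (weight_gt0 g).
Qed.

Lemma affine_dist_le g h k : abs2 (affine_point g k - affine_point h k) <=
  6 * (1 + 2 * e%:R) ^+ 2 * sqdist (grid_point g) (grid_point h).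
Proof.
set D := sqdist _ _; set z := affine_point g k; set z' := affine_point h k.
have D0 : 0 <= D by apply: sumr_ge0 => ? _; apply: sumr_ge0 => ? _; exact: abs2_ge0.
have zE : (weight g)%:C%C * (z - z') =
  ((weight g)%:C%C * z - (weight h)%:C%C * z') + z' * ((weight h)%:C%C - (weight g)%:C%C) by ring.
have H : weight g ^+ 2 * abs2 (z - z') <= 6 * D.
  rewrite -abs2_real -abs2M zE; apply: le_trans (abs2D _ _) _.
  have h1 : abs2 ((weight g)%:C%C * z - (weight h)%:C%C * z') <= D.
    by rewrite -!projector_grid abs2_projector_le.
  have h2 : abs2 z' * abs2 ((weight h)%:C%C - (weight g)%:C%C) <= 2 * D.
    apply: ler_pM; rewrite ?abs2_ge0//; first exact: abs2_affine_point_le2.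
    by rewrite -!projector_grid0 /D sqdistC abs2_projector_le.
  by rewrite abs2M; lra.
apply: le_trans (_ : ((1 + 2 * e%:R) * weight g) ^+ 2 * abs2 (z - z') <= _).
  rewrite -[leLHS]mul1r ler_wpM2r ?abs2_ge0// exprn_ege1//; exact: weight_ge.
by rewrite exprMn -[leLHS]mulrA [6 * _]mulrC -[leRHS]mulrA ler_wpM2l ?sqr_ge0.
Qed.

Lemma grid_dist_le g h j : (`|g j - h j|%N)%:R ^+ 2 <=
  n%:R ^+ 2 * (6 * (1 + 2 * e%:R) ^+ 2 * sqdist (grid_point g) (grid_point h)) :> R.
Proof.
have n0R : 0 < n%:R :> R by rewrite ltr0n.
case: j => k b; rewrite -ler_pdivrMl ?exprn_gt0//; apply: le_trans (affine_dist_le g h k).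
have E i : n%:R ^- 2 * (`|g i - h i|%N)%:R ^+ 2 = ((g i)%:R / n%:R - (h i)%:R / n%:R) ^+ 2 :> R.
  rewrite natr_absz -mulrBl exprMn exprVn mulrC; congr (_ * _).
  by rewrite intr_norm real_normK ?num_real// rmorphB.
rewrite E abs2_re_im !raddfB /=.
by case: b; rewrite ?lerDl ?lerDr sqr_ge0.
Qed.

End ProjectiveGrid.

Section ComplexSeparation.
Context {R : realType}.
Local Notation K := (scalarH R ComplexScalars).
Variables (e : nat) (s : R).
Hypothesis e0 : (0 < e)%N.
Hypothesis s_gt : (2 * e)%:R < s.
Local Notation index := ('I_e * bool)%type.
Local Notation th := (s / (2 * e)%:R).
Local Notation L := (7 * (1 + 2 * e%:R) : R).

Let e2 : 0 < (2 * e)%:R :> R.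
Proof. by rewrite ltr0n muln_gt0. Qed.

Let th1 : 1 < th.
Proof. by rewrite ltr_pdivlMr// mul1r. Qed.

Let s0 : 0 < s.
Proof. exact: lt_trans s_gt. Qed.

Let L0 : 0 < L.
Proof. by rewrite mulr_gt0// ltr_wpDr// mulr_ge0. Qed.

Section FixedScale.
Variable n : nat.
Hypothesis n0 : (0 < n)%N.
Local Notation grid := {ffun index -> 'I_n}.
Local Notation rho := ((L * n%:R)^-1).
Local Notation gpt := (@grid_point R e n).

Let n0R : 0 < n%:R :> R. Proof. by rewrite ltr0n. Qed.
Let rho0 : 0 < rho. Proof. by rewrite invr_gt0 mulr_gt0. Qed.

(* a constant replaces the triangle inequality *)
Lemma exists_nearest_grid_point (y : 'cV[K]_e.+1) : vnorm y = 1 ->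
  exists h : grid, forall (g : grid) (j : index),
    (rho * (`|g j - h j|%N)%:R) ^+ 2 <= 1 - absH (inner (gpt g) y) ^+ 2.
Proof.
move=> y1; pose D (g : grid) := sqdist (gpt g) y.
have [h _ hmin] := @arg_minP _ _ _ ([ffun=> Ordinal n0] : grid) xpredT D isT.
exists h => g j; have := @grid_dist_le R e n n0 g h j.
have : sqdist (gpt g) (gpt h) <= 8 * (1 - absH (inner (gpt g) y) ^+ 2).
  apply: le_trans (sqdist_triangle y _ _) _; rewrite [sqdist y _]sqdistC.
  have := hmin g isT; rewrite /D.
  have := sqdistE (vnorm_grid_point g) y1 => ->; lra.
set q := 1 - _; set S := sqdist _ _; set P := 1 + 2 * e%:R => Sq H.
have W0 : 0 <= (n%:R * P) ^+ 2 by exact: sqr_ge0.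
have S0 : 0 <= S by apply: sumr_ge0 => ? _; apply: sumr_ge0 => ? _; exact: abs2_ge0.
have H2 : (`|g j - h j|%N)%:R ^+ 2 <= (7 * P * n%:R) ^+ 2 * q.
  apply: le_trans H _.
  have h1 : 0 <= (n%:R * P) ^+ 2 * (8 * q - S) by rewrite mulr_ge0//; lra.
  have h2 : 0 <= (n%:R * P) ^+ 2 * q by rewrite mulr_ge0//; lra.
  move: h1 h2; rewrite !exprMn !expr2; lra.
have P0 : 0 < P by rewrite ltr_wpDr// mulr_ge0.
by rewrite exprMn exprVn ler_pdivrMl ?exprn_gt0 ?mulr_gt0//.
Qed.

Lemma kernel_grid_le (y : 'cV[K]_e.+1) : vnorm y = 1 ->
  exists h : grid, forall g : grid,
    kernel (truncated s rho) (absH (inner (gpt g) y)) 1 <=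
    \prod_(j : index) decay th `|g j - h j|%N.
Proof.
move=> y1; have [h hP] := exists_nearest_grid_point y1; exists h => g.
pose j0 : index := (Ordinal e0, true).
have [js _ jmax] := @arg_maxnP _ j0 xpredT (fun j => `|g j - h j|%N) isT.
set M := maxn 1 `|g js - h js|%N.
have M1 : 1 <= M%:R :> R by rewrite ler1n leq_max.
have M0 : 0 < M%:R :> R by apply: lt_le_trans M1.
apply: le_trans (_ : M%:R `^ (- s) <= _); last first.
  rewrite [leLHS](_ : _ = \prod_(j : index) M%:R `^ (- th)); last first.
    rewrite prodr_const card_prod card_ord card_bool -powR_mulrn ?powR_ge0// -powRrM.
    by congr (_ `^ _); rewrite mulNr [(e * 2)%N]mulnC divfK// gt_eqF.
  apply: ler_prod => j _; rewrite powR_ge0 /decay !powRN lef_pV2 ?posrE ?powR_gt0 ?ltr0n ?leq_max//.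
  rewrite ge0_ler_powR ?nnegrE// ?(le_trans ler01 (ltW th1))//.
  rewrite ler_nat /M geq_max leq_maxl/= leq_max; apply/orP; right; exact: jmax.
have := hP g js; rewrite /kernel; set a := absH _; case: ifPn => [a1|].
  rewrite divr1 => H; rewrite /truncated ge_min; apply/orP.
  have [d1|d1] := leqP `|g js - h js|%N 1.
    by left; rewrite /M (maxn_idPl d1) powR1.
  right; have q0 : 0 < 1 - a ^+ 2 by rewrite subr_gt0.
  have ME : M = `|g js - h js|%N by apply/maxn_idPr; exact: ltnW.
  move: H; rewrite -ME => H.
  have -> : M%:R `^ (- s) = rho `^ s * ((rho * M%:R) ^+ 2) `^ (- (s / 2)).
    rewrite -[(rho * _) ^+ 2]powR_mulrn ?mulr_ge0 ?(ltW rho0)// -powRrM.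
    rewrite (_ : 2 * - (s / 2) = - s); last by field.
    rewrite powRM ?(ltW rho0)// mulrA -powRD ?(gt_eqF rho0) ?implybT//.
    by rewrite subrr powRr0 mul1r.
  rewrite ler_wpM2l ?powR_ge0// !powRN lef_pV2 ?posrE ?powR_gt0 ?exprn_gt0 ?mulr_gt0//.
  rewrite ge0_ler_powR ?nnegrE ?sqr_ge0 ?(ltW q0)//.
  by rewrite divr_ge0// ltW.
rewrite -leNgt => a1 H.
have : (rho * (`|g js - h js|%N)%:R) ^+ 2 = 0.
  by apply/eqP; rewrite eq_le sqr_ge0 andbT (le_trans H)// subr_le0.
move/eqP; rewrite sqrf_eq0 mulf_eq0 (gt_eqF rho0)/= pnatr_eq0 => /eqP d0.
by rewrite /M d0 powR1.
Qed.

Lemma complex_gap N (X : configuration R ComplexScalars e.+1 N) (i : 'I_N) :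
  N%:R * (2 * decay_sum th) ^+ (2 * e) <= n%:R ^+ (2 * e) -> unit_configs X ->
  exists2 x : 'cV[K]_e.+1, vnorm x = 1 &
    \sum_(l < N | l != i) kernel (truncated s rho) (absH (inner x (X l))) 1 < 1.
Proof.
move=> Nn X1.
have [//|none] := pselect (exists2 x : 'cV[K]_e.+1, vnorm x = 1 &
    \sum_(l < N | l != i) kernel (truncated s rho) (absH (inner x (X l))) 1 < 1).
have big_sum (g : grid) : 1 <= \sum_(l < N | l != i) kernel (truncated s rho) (absH (inner (gpt g) (X l))) 1.
  rewrite leNgt; apply/negP => H; apply: none.
  by exists (gpt g) => //; exact: vnorm_grid_point.
have S0 : 0 < 2 * decay_sum th.
  by rewrite mulr_gt0// addr_gt0// invr_gt0 subr_gt0.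
have per l : \sum_(g : grid) kernel (truncated s rho) (absH (inner (gpt g) (X l))) 1
    <= (2 * decay_sum th) ^+ (2 * e).
  have [h hP] := kernel_grid_le (X1 l).
  apply: le_trans (ler_sum _ (fun g _ => hP g)) _.
  rewrite -(bigA_distr_bigA (fun j (a : 'I_n) => decay th `|a - h j|%N)).
  rewrite [leRHS](_ : _ = \prod_(j : index) (2 * decay_sum th)); last first.
    by rewrite prodr_const card_prod card_ord card_bool mulnC.
  apply: ler_prod => j _; rewrite sum_decay_dist_le// andbT.
  by apply: sumr_ge0 => a _; exact: powR_ge0.
have : \sum_(g : grid) 1 <= \sum_(l < N | l != i) (2 * decay_sum th) ^+ (2 * e).
  apply: le_trans (ler_sum _ (fun (g : grid) _ => big_sum g)) _.
  by rewrite exchange_big/=; apply: ler_sum => l _; exact: per.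
rewrite !sumr_const card_ffun card_prod !card_ord card_bool cardC1 card_ord.
rewrite natrX [(e * 2)%N]mulnC => H.
have N0 : (0 < N)%N by exact: leq_ltn_trans (ltn_ord i).
have : N.-1%:R * (2 * decay_sum th) ^+ (2 * e) < N%:R * (2 * decay_sum th) ^+ (2 * e).
  by rewrite ltr_pM2r ?exprn_gt0// ltr_nat prednK.
by move: H Nn; rewrite -mulr_natl; lra.
Qed.

End FixedScale.

Lemma complex_separation : exists2 C : R, 0 < C &
  forall N (X : configuration R ComplexScalars e.+1 N), (2 <= N)%N -> minimizer s X ->
    coherence X <= 1 - C ^+ 2 / 2 * N%:R `^ (- (2 / (2 * e)%:R)).
Proof.
pose S := 2 * decay_sum th.
have S1 : 1 <= S.
  rewrite /S /decay_sum; have : 0 < (th - 1)^-1 by rewrite invr_gt0 subr_gt0.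
  lra.
have S0 : 0 < S by exact: lt_le_trans ltr01 S1.
have LS0 : 0 < 2 * L * S by rewrite mulr_gt0// mulr_gt0.
exists (2 * L * S)^-1; first by rewrite invr_gt0.
move=> N X N2 minX.
have N1 : 1 <= N%:R :> R by rewrite ler1n; exact: ltnW.
have N0 : 0 < N%:R :> R by apply: lt_le_trans N1.
pose r : R := N%:R `^ ((2 * e)%:R^-1).
have r1 : 1 <= r.
  by rewrite /r -[leLHS](powRr0 N%:R) ler_powR// invr_ge0 ltW.
pose n := (Num.truncn (S * r)).+1.
have Sr1 : 1 <= S * r by apply: mulr_ege1.
have [nl nu] : S * r < n%:R /\ n%:R <= 2 * (S * r).
  have Sr0 : 0 <= S * r by lra.
  have /andP[h1 h2] := truncn_itv Sr0; split => //.
  by rewrite /n -natr1; lra.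
have n0R : 0 < n%:R :> R by rewrite ltr0n.
have rho0 : 0 < (L * n%:R)^-1 by rewrite invr_gt0 mulr_gt0.
have Nn : N%:R * S ^+ (2 * e) <= n%:R ^+ (2 * e).
  have -> : N%:R = r ^+ (2 * e).
    by rewrite /r -powR_mulrn ?powR_ge0// -powRrM mulVf ?powRr1 ?ltW// gt_eqF.
  rewrite -exprMn mulrC lerXn2r ?nnegrE ?(ltW nl)//; exact: le_trans Sr1.
have gap (Y : configuration R ComplexScalars e.+1 N) i : unit_configs Y -> _ :=
  fun Y1 => complex_gap (ltn0Sn _) i Nn Y1.
have sep i j := minimizer_separated s0 rho0 gap minX (i := i) (j := j).
set rho := (L * n%:R)^-1 in rho0 sep.
have rho_ge : (2 * L * S)^-1 ^+ 2 * N%:R `^ (- (2 / (2 * e)%:R)) <= rho ^+ 2.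
  have -> : N%:R `^ (- (2 / (2 * e)%:R)) = r^-1 ^+ 2 :> R.
    rewrite /r -powRN -powR_mulrn ?powR_ge0// -powRrM; congr (_ `^ _).
    by rewrite mulNr mulrC.
  have r0 : 0 < r by exact: lt_le_trans ltr01 r1.
  have LSr0 := mulr_gt0 LS0 r0; have Ln0 := mulr_gt0 L0 n0R.
  rewrite -exprMn -invfM lerXn2r ?nnegrE ?invr_ge0 ?(ltW LSr0) ?(ltW Ln0)//.
  rewrite lef_pV2 ?posrE//.
  rewrite (_ : 2 * L * S * r = L * (2 * (S * r))); last by ring.
  by rewrite ler_pM2l.
rewrite mulrAC.
have rho1 : rho ^+ 2 <= 1.
  rewrite exprn_ile1 ?(ltW rho0)// invf_le1 ?mulr_gt0//.
  apply: mulr_ege1; last by rewrite ler1n.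
  have : 0 <= e%:R :> R by []. 
  lra.
apply: coherence_le => [|i j ij]; first lra.
have a0 := absH_ge0 (inner (X i) (X j)); have := sep i j ij; move: rho_ge rho1 a0.
set a := absH _; set P := rho ^+ 2; set Q := _ * _ => QP P1 a0 aP.
rewrite -(@ler_pXn2r _ 2) ?nnegrE//; last lra.
have := sqr_ge0 Q; move: aP; rewrite !expr2; lra.
Qed.

End ComplexSeparation.

Theorem theorem6p3 (R : realType) (H : scalars) (d : nat) (s : R)
  (d_ge2 : (2 <= d)%N) (s_gt : (dimD H d)%:R < s) :
  (exists C2 : R,
    [/\ 0 < C2,
        H = RealScalars -> C2 = C2real d s
      & forall (N : nat) (X : configuration R H d N), (2 <= N)%N ->
          minimizer s X ->
          coherence X <= 1 - C2 ^+ 2 / 2 * N%:R `^ (- (2 / (dimD H d)%:R))])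
  /\
  (forall X : forall N : nat, configuration R H d N,
    (forall N : nat, (2 <= N)%N -> minimizer s (X N)) -> well_separated X).
Proof.
have bound : exists C2 : R,
    [/\ 0 < C2,
        H = RealScalars -> C2 = C2real d s
      & forall (N : nat) (X : configuration R H d N), (2 <= N)%N ->
          minimizer s X ->
          coherence X <= 1 - C2 ^+ 2 / 2 * N%:R `^ (- (2 / (dimD H d)%:R))].
  case: H s_gt => s_gt.
  - case: d d_ge2 s_gt => [|[|k]]// _; rewrite /dimD subn1 /= => s_gt.
    exists (C2real k.+2 s); split=> //; first exact: C2real_gt0.
    by move=> N X N2 minX; exact: real_separation.
  - case: d d_ge2 s_gt => [|e]// e0; rewrite /dimD.
    have -> : (2 * e.+1 - 2 = 2 * e)%N by rewrite mulnSr addnK.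
    move=> s_gt; have [C C0 CP] := complex_separation e0 s_gt.
    by exists C; split=> // N X; exact: CP.
split=> // X minX; have [C2 [C20 _ C2P]] := bound.
split; first by move=> N /minX[].
by exists (C2 ^+ 2); rewrite ?exprn_gt0// => N N2; exact: C2P (minX N N2).
Qed.
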